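(* Let $\mathfrak{s}=(s_1,\ldots,s_r)\in\mathbb{N}^r$ and $\mathbf{u}=(u_1,\ldots,u_r)\in\overline{K}^r$ with $|u_i|_\infty\le q^{\frac{s_iq}{q-1}}$ for $1\le i\le r-1$ and $|u_r|_\infty<q^{\frac{s_rq}{q-1}}$. Let $G=G_{\mathfrak{s},\mathbf{u}}$ and $\mathbf{v}=\mathbf{v}_{\mathfrak{s},\mathbf{u}}$ be as in the context, and define $\mathbf{Y}_{\mathfrak{s},\mathbf{u}}=(Y_1^{\mathrm{tr}},\ldots,Y_r^{\mathrm{tr}})^{\mathrm{tr}}\in\mathbb{C}_\infty^d$, where for each $1\le i\le r$ \[ Y_i=\begin{pmatrix}(-1)^{r-i}\big(\partial_t^{d_i-1}\mathfrak{Li}^\star_{(s_r,\ldots,s_i),(u_r,\ldots,u_i)}\big)|_{t=\theta}\\ (-1)^{r-i}\big(\partial_t^{d_i-2}\mathfrak{Li}^\star_{(s_r,\ldots,s_i),(u_r,\ldots,u_i)}\big)|_{t=\theta}\\ \vdots\\ (-1)^{r-i}\big(\partial_t^{0}\mathfrak{Li}^\star_{(s_r,\ldots,s_i),(u_r,\ldots,u_i)}\big)|_{t=\theta}\end{pmatrix}\in\mathbb{C}_\infty^{d_i}, \] whose last entry is $(-1)^{r-i}\mathrm{Li}^\star_{(s_r,\ldots,s_i)}(u_r,\ldots,u_i)$. Then $\mathrm{Log}_G(\mathbf{v})=\mathbf{Y}_{\mathfrak{s},\mathbf{u}}$.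
   Context: $q$ is a power of a prime $p$, $A=\mathbb{F}_q[\theta]$, $K=\mathbb{F}_q(\theta)$, $|\cdot|_\infty$ is the absolute value on $K$ with $|\theta|_\infty=q$, $K_\infty=\mathbb{F}_q((1/\theta))$, $\mathbb{C}_\infty$ is the completion of an algebraic closure of $K_\infty$, $\overline{K}$ the algebraic closure of $K$ in $\mathbb{C}_\infty$; $t$ is a variable independent of $\theta$. For $f=\sum a_it^i\in\mathbb{C}_\infty((t))$ and $n\in\mathbb{Z}$ put $f^{(n)}=\sum a_i^{q^n}t^i$ (applied entrywise to matrices). $\mathbb{T}_\theta$ is the ring of power series $\sum b_it^i\in\mathbb{C}_\infty[[t]]$ with $|b_i\theta^i|_\infty\to0$. The $n$-th hyperderivative is $\partial_t^n(\sum_i a_it^i)=\sum_i\binom{i}{n}a_it^{i-n}$ (binomial mod $p$); it maps $\mathbb{T}_\theta$ to $\mathbb{T}_\theta$, and for $f\in\mathbb{T}_\theta$, $(\partial_t^nf)|_{t=\theta}$ is the $n$-th Taylor coefficient of $f$ at $t=\theta$. Let $L_0=\mathbb{L}_0=1$, $L_i=\prod_{k=1}^i(\theta-\theta^{q^k})$, $\mathbb{L}_i=\prod_{k=1}^i(t-\theta^{q^k})$. For an index $\mathfrak{n}=(n_1,\ldots,n_k)\in\mathbb{N}^k$ and $\mathbf{w}=(w_1,\ldots,w_k)\in\overline{K}^k$ with $|w_1|_\infty<q^{n_1q/(q-1)}$ and $|w_i|_\infty\le q^{n_iq/(q-1)}$ ($i\ge2$), the $t$-motivic Carlitz multiple star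 polylogarithm $\mathfrak{Li}^\star_{\mathfrak{n},\mathbf{w}}(t)=\sum_{i_1\ge\cdots\ge i_k\ge0}\frac{w_1^{q^{i_1}}\cdots w_k^{q^{i_k}}}{\mathbb{L}_{i_1}^{n_1}\cdots\mathbb{L}_{i_k}^{n_k}}$ converges in $\mathbb{T}_\theta$ and its value at $t=\theta$ is $\mathrm{Li}^\star_{\mathfrak{n}}(\mathbf{w})=\sum_{i_1\ge\cdots\ge i_k\ge0}\frac{w_1^{q^{i_1}}\cdots w_k^{q^{i_k}}}{L_{i_1}^{n_1}\cdots L_{i_k}^{n_k}}$. The $t$-module $G_{\mathfrak{s},\mathbf{u}}$: put $d_i=s_i+\cdots+s_r$ ($1\le i\le r$), $d=d_1+\cdots+d_r$; write $d\times d$ matrices in blocks $B[\ell m]$ of size $d_\ell\times d_m$. Let $N$ be block diagonal with $\ell$-th diagonal block the $d_\ell\times d_\ell$ matrix with $1$'s on the first superdiagonal and $0$ elsewhere; let $E$ be the block matrix with $E[\ell m]=0$ if $\ell>m$, and for $\ell\le m$, $E[\ell m]$ has a single possibly nonzero entry in its lower-left corner (row $d_\ell$, column $1$), equal to $1$ if $\ell=m$ and to $(-1)^{m-\ell}\prod_{e=\ell}^{m-1}u_e$ if $\ell<m$. $G=G_{\mathfrak{s},\mathbf{u}}$ is $\mathbb{G}_a^d$ with the $\mathbb{F}_q[t]$-action given by the $\mathbb{F}_q$-linear ring homomorphism $\rho:\mathbb{F}_q[t]\to\mathrm{Mat}_d(\overline{K})[\tau]$, $\rho(t)=\theta I_d+N+E\tau$,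 where $\tau$ acts by $x\mapsto x^{(1)}$ (so $\rho(t)(x)=(\theta I_d+N)x+Ex^{(1)}$); $\partial\rho(a)$ denotes the $\tau^0$-coefficient of $\rho(a)$. Its exponential $\mathrm{Exp}_G(\mathbf{z})=\sum_{i\ge0}e_i\mathbf{z}^{(i)}$ ($e_0=I_d$, $e_i\in\mathrm{Mat}_d(\mathbb{C}_\infty)$) is the unique such entire $\mathbb{F}_q$-linear series with $\mathrm{Exp}_G(\partial\rho(t)\mathbf{z})=\rho(t)(\mathrm{Exp}_G(\mathbf{z}))$, and $\mathrm{Log}_G$ is its formal inverse power series. The point $\mathbf{v}=\mathbf{v}_{\mathfrak{s},\mathbf{u}}\in\overline{K}^d$ has $i$-th block (of length $d_i$) equal to $(0,\ldots,0,(-1)^{r-i}u_iu_{i+1}\cdots u_r)^{\mathrm{tr}}$. Under the stated hypotheses, $\mathrm{Log}_G$ converges at $\mathbf{v}$. *)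

(* Defs.v *)
From mathcomp Require Import all_boot all_order all_algebra.
From mathcomp Require Import all_classical all_reals all_analysis.

Set Implicit Arguments.
Unset Strict Implicit.
Unset Printing Implicit Defensive.

Import Order.TTheory GRing.Theory Num.Theory.
Import numFieldNormedType.Exports.

Local Open Scope classical_set_scope.
Local Open Scope ring_scope.

(* Throughout, F plays the role of F_q with q = #|F|, and the rational function
   field K = F_q(theta) is {fraction {poly F}}, theta being the class of 'X. *)
Record valuedExt (F : finFieldType) (R : realType) := ValuedExt {
  vfield :> fieldType;
  vemb : {rmorphism {fraction {poly F}} -> vfield};
  vabs : vfield -> R
}.

Definition theta (F : finFieldType) (R : realType) (C : valuedExt F R) : C :=
  vemb C (tofrac ('X : {poly F})).

Definition constC (F : finFieldType) (R : realType) (C : valuedExt F R)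
    (c : F) : C :=
  vemb C (tofrac (c%:P : {poly F})).

Definition cvg_to_C (F : finFieldType) (R : realType) (C : valuedExt F R)
    (x : nat -> C) (l : C) : Prop :=
  vabs (x n - l) @[n --> \oo] --> (0 : R).

Definition cauchy_C (F : finFieldType) (R : realType) (C : valuedExt F R)
    (x : nat -> C) : Prop :=
  forall e : R, 0 < e -> exists N : nat,
    forall m n : nat, (N <= m)%N -> (N <= n)%N -> vabs (x m - x n) < e.

(* F_q((1/theta)) inside C: the sums of the Laurent series
   \sum_(i >= 0) c_i theta^(N - i). *)
Definition in_Kinfty (F : finFieldType) (R : realType) (C : valuedExt F R)
    (x : C) : Prop :=
  exists (N : nat) (c : nat -> F),
    cvg_to_C (fun n => \sum_(i < n) constC C (c i) * theta C ^+ N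
                                     / theta C ^+ i) x.

Definition algebraic_over_Kinfty (F : finFieldType) (R : realType)
    (C : valuedExt F R) (x : C) : Prop :=
  exists p : {poly C},
    [/\ p != 0, forall i, in_Kinfty p`_i & root p x].

(* C is the completion of an algebraic closure of F_q((1/theta)): an
   ultrametric complete field in which |theta| = q, such that the elements
   algebraic over K_infty form an algebraic closure of K_infty
   (vabs_closed) and are dense (vabs_dense).  The restriction of the absolute
   value to K, hence to K_infty and to its algebraic closure, is determined by
   |theta| = q, so C is determined up to isometric isomorphism. *)
Record is_Cinfty (F : finFieldType) (R : realType) (C : valuedExt F R) :
    Prop := IsCinfty {
  vabs_ge0 : forall x : C, 0 <= vabs x;
  vabs_eq0 : forall x : C, vabs x = 0 <-> x = 0;
  vabsM : forall x y : C, vabs (x * y) = vabs x * vabs y;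
  vabs_ultra : forall x y : C, vabs (x + y) <= Num.max (vabs x) (vabs y);
  vabs_theta : vabs (theta C) = #|F|%:R;
  vabs_complete : forall x : nat -> C,
    cauchy_C x -> exists l : C, cvg_to_C x l;
  vabs_closed : forall p : {poly C},
    (forall i, in_Kinfty p`_i) -> (1 < size p)%N -> exists x : C, root p x;
  vabs_dense : forall (x : C) (e : R), 0 < e ->
    exists2 y : C, algebraic_over_Kinfty y & vabs (x - y) < e
}.

Definition in_Kbar (F : finFieldType) (R : realType) (C : valuedExt F R)
    (x : C) : Prop := algebraicOver (vemb C) x.

(* The limit of x, and 0 if x diverges. *)
Definition lim_C (F : finFieldType) (R : realType) (C : valuedExt F R)
    (x : nat -> C) : C :=
  xget 0 [set l | cvg_to_C x l].

(* An element of C[[t]] is represented by its sequence of coefficients. *)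
Definition ps_one (C : fieldType) : nat -> C := fun j => (j == 0%N)%:R.

Definition ps_mul (C : fieldType) (f g : nat -> C) : nat -> C :=
  fun j => \sum_(i < j.+1) f i * g (j - i)%N.

Definition ps_exp (C : fieldType) (f : nat -> C) (n : nat) : nat -> C :=
  iter n (ps_mul f) (ps_one C).

(* The expansion of 1 / (t - a) at t = 0, for a != 0. *)
Definition ps_invXsub (C : fieldType) (a : C) : nat -> C :=
  fun j => - a ^- j.+1.

Lemma ps_invXsubP (C : fieldType) (a : C) : a != 0 ->
  ps_mul (fun j => ('X - a%:P)`_j) (ps_invXsub a) =1 ps_one C.
Proof.
move=> a0 [|j]; rewrite /ps_mul /ps_invXsub /ps_one.
  by rewrite big_ord1 coefB coefX coefC /= sub0r mulrNN expr1 divff.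
rewrite big_ord_recl big_ord_recl big1 => [|i _].
  rewrite !coefB !coefX !coefC /= sub0r subr0 mul1r addr0 mulrNN subn0 subSS.
  by rewrite subn0 [in a ^- _]exprS invfM mulrA divff // mul1r subrr.
by rewrite coefB coefX coefC /= subr0 mul0r.
Qed.

Definition hyperderiv (C : fieldType) (n : nat) (f : nat -> C) : nat -> C :=
  fun j => f (j + n)%N *+ 'C(j + n, n).

Definition in_Tate (F : finFieldType) (R : realType) (C : valuedExt F R)
    (f : nat -> C) : Prop :=
  cvg_to_C (fun j => f j * theta C ^+ j) 0.

(* Convergence in T_theta, for the norm f |-> sup_j |f_j theta^j|. *)
Definition cvg_to_Tate (F : finFieldType) (R : realType) (C : valuedExt F R)
    (S : nat -> nat -> C) (f : nat -> C) : Prop :=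
  in_Tate f /\
  forall e : R, 0 < e -> \forall M \near \oo,
    forall j : nat, vabs ((S M j - f j) * theta C ^+ j) <= e.

Definition lim_Tate (F : finFieldType) (R : realType) (C : valuedExt F R)
    (S : nat -> nat -> C) : nat -> C :=
  xget (fun=> 0) [set f | cvg_to_Tate S f].

Definition eval_theta (F : finFieldType) (R : realType) (C : valuedExt F R)
    (f : nat -> C) : C :=
  lim_C (fun m => \sum_(j < m) f j * theta C ^+ j).

(* i_1 >= ... >= i_k *)
Definition nonincr (k M : nat) (i : {ffun 'I_k -> 'I_M}) : bool :=
  [forall a : 'I_k, forall b : 'I_k, (a <= b)%N ==> (i b <= i a)%N].

Definition inv_bbL (F : finFieldType) (R : realType) (C : valuedExt F R)
    (i : nat) : nat -> C :=
  \big[@ps_mul C/ps_one C]_(1 <= k < i.+1)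
    ps_invXsub (theta C ^+ (#|F| ^ k)%N).

Definition Lfactor (F : finFieldType) (R : realType) (C : valuedExt F R)
    (i : nat) : C :=
  \prod_(1 <= k < i.+1) (theta C - theta C ^+ (#|F| ^ k)%N).

(* Partial sums, over M > i_1 >= ... >= i_k >= 0, of the t-motivic Carlitz
   multiple star polylogarithm.  The index n and the argument w are sequences
   of the same size k. *)
Definition tLi_partial (F : finFieldType) (R : realType) (C : valuedExt F R)
    (n : seq nat) (w : seq C) (M : nat) : nat -> C :=
  fun j => \sum_(i : {ffun 'I_(size n) -> 'I_M} | nonincr i)
    (\prod_(a < size n) w`_a ^+ (#|F| ^ i a)%N) *
    (\big[@ps_mul C/ps_one C]_(a < size n)
        ps_exp (inv_bbL C (i a)) (nth 0%N n a)) j.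

Definition tLi (F : finFieldType) (R : realType) (C : valuedExt F R)
    (n : seq nat) (w : seq C) : nat -> C :=
  lim_Tate (tLi_partial n w).

Definition Li_partial (F : finFieldType) (R : realType) (C : valuedExt F R)
    (n : seq nat) (w : seq C) (M : nat) : C :=
  \sum_(i : {ffun 'I_(size n) -> 'I_M} | nonincr i)
    \prod_(a < size n)
      (w`_a ^+ (#|F| ^ i a)%N / Lfactor C (i a) ^+ nth 0%N n a).

(* Blocks are indexed by 'I_r, starting from 0: with l : 'I_r standing for the
   1-based index l + 1, the length d_(l+1) is s_(l+1) + ... + s_r, and
   (s_r, ..., s_(l+1)) is rev (drop l s). *)
Definition bdim (r : nat) (s : r.-tuple nat) (l : 'I_r) : nat :=
  \sum_(x <- drop l s) x.

Definition tdim (r : nat) (s : r.-tuple nat) : nat := \sum_(l < r) bdim s l.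

Definition Nmx (C : fieldType) (r : nat) (s : r.-tuple nat) :
    'M[C]_(tdim s) :=
  \mxdiag_(l < r)
    (\matrix_(a < bdim s l, b < bdim s l) ((b == a.+1 :> nat)%:R : C)).

Definition Emx (C : fieldType) (r : nat) (s : r.-tuple nat)
    (u : r.-tuple C) : 'M[C]_(tdim s) :=
  \mxblock_(l < r, m < r)
    (\matrix_(a < bdim s l, b < bdim s m)
       if [&& (l <= m)%N, a.+1 == bdim s l & b == 0%N :> nat]
       then (-1) ^+ (m - l) * \prod_(l <= e < m) u`_e
       else (0 : C)).

Definition vpoint (C : fieldType) (r : nat) (s : r.-tuple nat)
    (u : r.-tuple C) : 'cV[C]_(tdim s) :=
  \mxcol_(l < r)
    (\col_(a < bdim s l)
       if a.+1 == bdim s l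
       then (-1) ^+ (r.-1 - l) * \prod_(x <- drop l u) x
       else (0 : C)).

Definition twist (F : finFieldType) (R : realType) (C : valuedExt F R)
    (n : nat) (d m : nat) (A : 'M[C]_(d, m)) : 'M[C]_(d, m) :=
  map_mx (fun x : C => x ^+ (#|F| ^ n)%N) A.

Definition drho_t (F : finFieldType) (R : realType) (C : valuedExt F R)
    (r : nat) (s : r.-tuple nat) : 'M[C]_(tdim s) :=
  (theta C)%:M + Nmx C s.

Definition rho_t (F : finFieldType) (R : realType) (C : valuedExt F R)
    (r : nat) (s : r.-tuple nat) (u : r.-tuple C) (x : 'cV[C]_(tdim s)) :
    'cV[C]_(tdim s) :=
  drho_t C s *m x + Emx s u *m twist 1 x.

Definition cvg_to_vec (F : finFieldType) (R : realType) (C : valuedExt F R)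
    (d : nat) (x : nat -> 'cV[C]_d) (y : 'cV[C]_d) : Prop :=
  forall a : 'I_d, cvg_to_C (fun n => x n a 0) (y a 0).

(* A series \sum_i c_i tau^i with matrix coefficients is represented by its
   sequence of coefficients c; [tw_sum c z y] says that \sum_i c_i z^(i)
   converges, with sum y. *)
Definition tw_sum (F : finFieldType) (R : realType) (C : valuedExt F R)
    (d : nat) (c : nat -> 'M[C]_d) (z y : 'cV[C]_d) : Prop :=
  cvg_to_vec (fun n => \sum_(i < n) c i *m twist i z) y.

Definition tw_one (C : fieldType) (d : nat) : nat -> 'M[C]_d :=
  fun n => if n == 0%N then 1%:M else 0.

Definition tw_mul (F : finFieldType) (R : realType) (C : valuedExt F R)
    (d : nat) (b c : nat -> 'M[C]_d) : nat -> 'M[C]_d :=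
  fun n => \sum_(i < n.+1) b i *m twist i (c (n - i)%N).

Definition is_Exp (F : finFieldType) (R : realType) (C : valuedExt F R)
    (r : nat) (s : r.-tuple nat) (u : r.-tuple C)
    (e : nat -> 'M[C]_(tdim s)) : Prop :=
  [/\ e 0%N = 1%:M,
      forall z, exists y, tw_sum e z y &
      forall z y, tw_sum e z y -> tw_sum e (drho_t C s *m z) (rho_t u y)].

Definition is_Log (F : finFieldType) (R : realType) (C : valuedExt F R)
    (d : nat) (e l : nat -> 'M[C]_d) : Prop :=
  tw_mul e l =1 tw_one C d /\ tw_mul l e =1 tw_one C d.

(* Row a, counted from 0, carries the hyperderivative of order d_i - 1 - a. *)
Definition Yblock (F : finFieldType) (R : realType) (C : valuedExt F R)
    (r : nat) (s : r.-tuple nat) (u : r.-tuple C) (i : 'I_r) :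
    'cV[C]_(bdim s i) :=
  \col_(a < bdim s i)
    ((-1) ^+ (r.-1 - i) *
     eval_theta (hyperderiv (bdim s i - a.+1)
                   (tLi (rev (drop i s)) (rev (drop i u))))).

Definition Yvec (F : finFieldType) (R : realType) (C : valuedExt F R)
    (r : nat) (s : r.-tuple nat) (u : r.-tuple C) : 'cV[C]_(tdim s) :=
  \mxcol_(i < r) Yblock s u i.

(* q^(n q / (q - 1)) *)
Definition polylog_radius (F : finFieldType) (R : realType) (n : nat) : R :=
  #|F|%:R `^ (n%:R * #|F|%:R / (#|F|%:R - 1)).

(* Main.v *)
(* Write N for the nilpotent part of [drho_t] and J for the map that sends a
   family (f_1, ..., f_r) in T_theta^r to the vector of the Taylor coefficients
   of f_i at t = theta of orders d_i - 1, ..., 0.  Multiplication by t in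
   T_theta corresponds under J to theta + N, that is, to d rho(t).

   The functional equation of the exponential gives, for the coefficients of the
   logarithm,
     (theta - theta^(q^n) + N) l_n = l_n N + l_(n-1) E^(n-1).
   Applied to the last basis vector eps_m of block m and iterated d_m times, it
   determines l_n eps_m from the l_(n-1) eps_k, and under J it becomes a
   recursion by division by (t - theta^(q^n))^(d_m).  It is solved by star sums:
   l_n eps_m is the image under J of
     (-1)^(m-k) T_n[k,m] / LL_n^(d_m)     in block k <= m,
   where T_n[k,m] is the sum over j_k <= ... <= j_(m-1) < n of the products of
   the u_e^(q^(j_e)) / LL_(j_e)^(s_e).  Consequently the n-th partial sum of
   Log(v) is exactly the image under J of the n-th partial sums of the
   polylogarithms, and it remains to let n tend to infinity in T_theta, on which
   J is continuous. *)
Require Import Defs.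
From mathcomp Require Import all_boot all_order all_algebra.
From mathcomp Require Import all_classical all_reals all_analysis.
From mathcomp Require Import ring zify.
From mathcomp Require fingroup abelian finfield.
From HB Require Import structures.

Set Implicit Arguments.
Unset Strict Implicit.
Unset Printing Implicit Defensive.

Import Order.TTheory GRing.Theory Num.Theory.
Import numFieldNormedType.Exports.

Local Open Scope classical_set_scope.
Local Open Scope ring_scope.

(* A copy of nat -> C carrying the convolution product instead of the pointwise
   one. *)
Definition pser (C : fieldType) : Type := nat -> C.

HB.instance Definition _ (C : fieldType) := GRing.Zmodule.on (pser C).

(** * Power series *)

Section PowerSeries.
Variable C : fieldType.
Implicit Types f g h : pser C.

(** The ring axioms are inherited from polynomials: a coefficient of a product depends only on
    truncations of the factors. *)
Let tr n f : {poly C} := \poly_(i < n) f i.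

Let ps_mul_tr n f g i : (i < n)%N -> ps_mul f g i = (tr n f * tr n g)`_i.
Proof.
move=> lt_in; rewrite coefM; apply: eq_bigr => j _.
by rewrite !coef_poly (leq_ltn_trans (leq_subr _ _) lt_in)
  (leq_ltn_trans _ lt_in) // -ltnS.
Qed.

Lemma ps_mulC : commutative (@ps_mul C).
Proof.
by move=> f g; apply/funext => i; rewrite !(@ps_mul_tr i.+1) // mulrC.
Qed.

Lemma ps_mulA : associative (@ps_mul C).
Proof.
move=> f g h; apply/funext => i.
transitivity ((tr i.+1 f * (tr i.+1 g * tr i.+1 h))`_i).
  rewrite coefM; apply: eq_bigr => j _.
  by rewrite coef_poly ltn_ord (@ps_mul_tr i.+1) // ltnS leq_subr.
rewrite mulrA coefM; apply: eq_bigr => j _.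
by rewrite coef_poly ltnS leq_subr (@ps_mul_tr i.+1) ?ltn_ord.
Qed.

Lemma ps_mul1 : left_id (@ps_one C) (@ps_mul C).
Proof.
move=> f; apply/funext => i; rewrite /ps_mul big_ord_recl big1 => [|j _].
  by rewrite /ps_one eqxx mul1r addr0 subn0.
by rewrite /ps_one mul0r.
Qed.

Lemma ps_mulDl : left_distributive (@ps_mul C) (+%R : pser C -> pser C -> pser C).
Proof.
move=> f g h; apply/funext => i; rewrite /ps_mul /GRing.add /=.
by rewrite -big_split; apply: eq_bigr => j _; rewrite mulrDl.
Qed.

Lemma ps_one_neq0 : (@ps_one C : pser C) != 0.
Proof. by apply/eqP => /(congr1 (@^~ 0%N)) /eqP; rewrite /ps_one oner_eq0. Qed.

HB.instance Definition _ := GRing.Zmodule_isComNzRing.Build (pser C)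
  ps_mulA ps_mulC ps_mul1 ps_mulDl ps_one_neq0.

Lemma pserD f g i : (f + g) i = f i + g i. Proof. by []. Qed.
Lemma pserN f i : (- f) i = - f i. Proof. by []. Qed.
Lemma pserB f g i : (f - g) i = f i - g i. Proof. by []. Qed.
Lemma pser_sum (I : Type) (s : seq I) (P : pred I) (F : I -> pser C) i :
  (\sum_(x <- s | P x) F x) i = \sum_(x <- s | P x) F x i.
Proof. by elim/big_rec2: _ => // x a b _ <-. Qed.

Lemma pserM f g i : (f * g) i = \sum_(j < i.+1) f j * g (i - j)%N.
Proof. by []. Qed.

Lemma ps_expE f n : ps_exp f n = f ^+ n.
Proof. by elim: n => // n IHn; rewrite exprS -IHn. Qed.

Definition pconst (c : C) : pser C := fun j => if j == 0%N then c else 0.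

Lemma pconstM c f i : (pconst c * f) i = c * f i.
Proof.
rewrite pserM big_ord_recl big1 ?addr0 ?subn0 // => j _.
by rewrite /pconst /= mul0r.
Qed.

Lemma pconst_is_zmod_morphism : zmod_morphism pconst.
Proof.
move=> a b; apply/funext => -[|i]; rewrite pserB /pconst //=.
by rewrite subr0.
Qed.

Lemma pconst_is_monoid_morphism : monoid_morphism pconst.
Proof.
split; first by apply/funext => -[|i].
move=> a b; apply/funext => i; rewrite pconstM /pconst.
by case: ifP; rewrite ?mulr0.
Qed.

HB.instance Definition _ :=
  GRing.isZmodMorphism.Build C (pser C) pconst pconst_is_zmod_morphism.
HB.instance Definition _ :=
  GRing.isMonoidMorphism.Build C (pser C) pconst pconst_is_monoid_morphism.

Definition pvar : pser C := fun j => (j == 1%N)%:R.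

Lemma pvarM f i : (pvar * f) i = if i is i'.+1 then f i' else 0.
Proof.
case: i => [|i]; rewrite pserM big_ord_recl /pvar mul0r add0r.
  by rewrite big_ord0.
rewrite big_ord_recl big1 => [|j _]; last by rewrite mul0r.
by rewrite mul1r addr0 subSS subn0.
Qed.

Lemma ps_invXsubK a : a != 0 ->
  (pvar - pconst a) * (ps_invXsub a : pser C) = 1.
Proof.
move=> a0; rewrite -[RHS]/(@ps_one C : pser C) -(funext (ps_invXsubP a0)).
congr (_ * _); apply/funext => -[|[|i]];
by rewrite pserB coefB coefX coefC /pconst /= ?subr0.
Qed.

End PowerSeries.

(** * Star sums *)

Section NonincreasingSums.
Variable A : comNzRingType.

(** Stated over any commutative ring, so that one recursion serves both the series in t and their
    values at theta. *)
Definition star_sum (k M : nat) (G : nat -> nat -> A) : A :=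
  \sum_(i : {ffun 'I_k -> 'I_M} | nonincr i) \prod_(a < k) G a (i a).

Lemma star_sum0 M G : star_sum 0 M G = 1.
Proof.
rewrite /star_sum (big_pred1 [ffun a : 'I_0 => widen_ord (leq0n M) a]) => [|i].
  by rewrite big_ord0.
rewrite /nonincr; apply/forallP/eqP => [_|_ []//]; by apply/ffunP => -[].
Qed.

Lemma star_sumS0 k G : star_sum k.+1 0 G = 0.
Proof. by rewrite /star_sum big1 // => i _; case: (i ord0). Qed.

Lemma nonincrP k M (i : {ffun 'I_k -> 'I_M}) :
  reflect (forall a b : 'I_k, (a <= b)%N -> (i b <= i a)%N) (nonincr i).
Proof.
apply: (iffP forallP) => [H a b le_ab|H a].
  by move/forallP/(_ b)/implyP: (H a); apply.
by apply/forallP => b; apply/implyP; apply: H.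
Qed.

(** Split by whether the largest index i_1 equals M. If it does, monotonicity leaves the other
    indices only the bound i <= M. *)
Lemma star_sumS k M G : star_sum k.+1 M.+1 G =
  star_sum k.+1 M G + G 0%N M * star_sum k M.+1 (fun a => G a.+1).
Proof.
rewrite /star_sum (bigID (fun i : {ffun _ -> _} => i ord0 == ord_max)) /= addrC.
congr (_ + _).
  (* [inord] in the inverse bijection requires a nonempty ordinal; for M = 0 both sums vanish. *)
  case: M => [|M].
    rewrite !big1 // => i; last by case/andP => _; rewrite !ord1.
    by case: (i ord0).
  rewrite (reindex_onto
    (fun j : {ffun 'I_k.+1 -> 'I_M.+1} => [ffun a => widen_ord (leqnSn _) (j a)])
    (fun i : {ffun 'I_k.+1 -> 'I_M.+2} => [ffun a => inord (i a)])) /=.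
    apply: eq_big => [j|j _]; last by apply: eq_bigr => a _; rewrite ffunE.
    rewrite ffunE -val_eqE /= neq_ltn ltn_ord andbT.
    have -> : [ffun a => inord ([ffun a0 => widen_ord (leqnSn M.+1) (j a0)] a)]
        == j by apply/eqP/ffunP => a; rewrite !ffunE inord_val.
    rewrite andbT; apply/nonincrP/nonincrP => H a b /H; by rewrite !ffunE.
  move=> i /andP[/nonincrP incr_i i0]; apply/ffunP => a; rewrite !ffunE.
  apply: val_inj => /=; rewrite inordK //.
  apply: leq_ltn_trans (incr_i ord0 a _) _ => //.
  by rewrite -val_eqE /= in i0; rewrite ltn_neqAle i0 -ltnS ltn_ord.
(* Chains with i_1 = M correspond to their tails, extended by M in front. *)
rewrite (reindex_onto
  (fun j : {ffun 'I_k -> 'I_M.+1} =>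
     [ffun a => if unlift ord0 a is Some a' then j a' else ord_max])
  (fun i : {ffun 'I_k.+1 -> 'I_M.+1} => [ffun a => i (lift ord0 a)])) /=.
  rewrite big_distrr /=; apply: eq_big => [j|j _].
    rewrite ffunE unlift_none eqxx andbT.
    have -> : [ffun a => [ffun a0 => if unlift ord0 a0 is Some a' then j a'
        else ord_max] (lift ord0 a)] == j.
      by apply/eqP/ffunP => a; rewrite !ffunE liftK.
    rewrite andbT; apply/nonincrP/nonincrP => H a b le_ab.
      by have := H (lift ord0 a) (lift ord0 b); rewrite !ffunE !liftK; apply.
    rewrite !ffunE; case: (unliftP ord0 a) le_ab => [a' ->|->]; last first.
      by case: unliftP => [b' _|_] _ //=; rewrite -ltnS.
    by case: (unliftP ord0 b) => [b' ->|->] //=; apply: H.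
  rewrite big_ord_recl ffunE unlift_none; congr (_ * _).
  by apply: eq_bigr => a _; rewrite ffunE liftK.
move=> i /andP[_ /eqP i0]; apply/ffunP => a; rewrite !ffunE.
by case: unliftP => [a' ->|->]; rewrite ?ffunE.
Qed.

End NonincreasingSums.

(** * Recursions for the partial sums of the polylogarithms *)

Section Polylog.
Variables (F : finFieldType) (R : realType) (C : valuedExt F R).
Implicit Types (n : seq nat) (w : seq C).

Definition tLi_factor (n : nat) (w : C) (M : nat) : pser C :=
  pconst (w ^+ (#|F| ^ M)%N) * (inv_bbL C M : pser C) ^+ n.

Definition Li_factor (n : nat) (w : C) (M : nat) : C :=
  w ^+ (#|F| ^ M)%N / Lfactor C M ^+ n.

Lemma tLi_partialE n w M : tLi_partial n w M =
  star_sum (size n) M (fun a => tLi_factor (nth 0%N n a) w`_a).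
Proof.
apply/funext => j; rewrite /star_sum pser_sum; apply: eq_bigr => i _.
under [in RHS]eq_bigr do rewrite /tLi_factor.
rewrite big_split /= -rmorph_prod /= pconstM; congr (_ * _).
by under eq_bigr do rewrite ps_expE.
Qed.

Lemma tLi_partial_nil w M : tLi_partial [::] w M = 1 :> pser C.
Proof. by rewrite tLi_partialE star_sum0. Qed.

Lemma tLi_partial0 (n1 : nat) n w : tLi_partial (n1 :: n) w 0 = 0 :> pser C.
Proof. by rewrite tLi_partialE star_sumS0. Qed.

Lemma tLi_partialS (n1 : nat) n (w1 : C) w M :
  tLi_partial (n1 :: n) (w1 :: w) M.+1 = tLi_partial (n1 :: n) (w1 :: w) M +
    tLi_factor n1 w1 M * tLi_partial n w M.+1 :> pser C.
Proof. by rewrite !tLi_partialE star_sumS. Qed.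

Lemma Li_partialE n w M : Li_partial n w M =
  star_sum (size n) M (fun a => Li_factor (nth 0%N n a) w`_a).
Proof. by []. Qed.

Lemma Li_partial_nil w M : Li_partial [::] w M = 1.
Proof. by rewrite Li_partialE star_sum0. Qed.

Lemma Li_partial0 (n1 : nat) n w : Li_partial (n1 :: n) w 0 = 0.
Proof. by rewrite Li_partialE star_sumS0. Qed.

Lemma Li_partialS (n1 : nat) n (w1 : C) w M :
  Li_partial (n1 :: n) (w1 :: w) M.+1 = Li_partial (n1 :: n) (w1 :: w) M +
    Li_factor n1 w1 M * Li_partial n w M.+1.
Proof. by rewrite !Li_partialE star_sumS. Qed.

Lemma inv_bbL0 : inv_bbL C 0 = 1 :> pser C.
Proof. by rewrite /inv_bbL big_geq. Qed.

Lemma inv_bbLS M : inv_bbL C M.+1 =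
  (inv_bbL C M : pser C) * (ps_invXsub (theta C ^+ (#|F| ^ M.+1)%N) : pser C)
  :> pser C.
Proof.
rewrite /inv_bbL.
exact: (@big_nat_recr _ _ (@GRing.mul (pser C))).
Qed.

End Polylog.

(** * The valued field C *)

Section Frobenius.
Variables (F : finFieldType) (R : realType) (C : valuedExt F R).

Lemma card_gt1 : (1 < #|F|)%N. Proof. exact: finfield.finNzRing_gt1. Qed.

(** The characteristic p of F passes to C along F -> F[X] -> K -> C, and the additive group of F is
    a p-group, so q is a power of p. This makes x |-> x^(q^n) additive on C. *)
Lemma pchar_vfield : [pchar C]%R.-nat #|F|.
Proof.
have [p p_pr charF] := finfield.finPcharP F.
have charC : p \in [pchar C].
  by apply/(rmorph_pchar (vemb C))/(rmorph_pchar (@tofrac _)); rewrite pchar_poly.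
have := abelian.abelem_pgroup (abelian.fin_ring_pchar_abelem charF).
by rewrite /pgroup.pgroup cardsT (eq_pnat _ (pcharf_eq charC)).
Qed.

Definition frob (n : nat) (x : C) : C := x ^+ (#|F| ^ n)%N.

Lemma frob_is_nmod_morphism n : nmod_morphism (frob n).
Proof.
split; first by rewrite /frob expr0n expn_eq0 -leqn0 leqNgt (ltnW card_gt1).
by move=> x y; rewrite /frob exprDn_pchar // pnatX pchar_vfield.
Qed.

Lemma frob_is_monoid_morphism n : monoid_morphism (frob n).
Proof. by split=> [|x y]; rewrite /frob ?expr1n ?exprMn. Qed.

HB.instance Definition _ n :=
  GRing.isNmodMorphism.Build C C (frob n) (frob_is_nmod_morphism n).
HB.instance Definition _ n :=
  GRing.isMonoidMorphism.Build C C (frob n) (frob_is_monoid_morphism n).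

Lemma twistE n d m (A : 'M[C]_(d, m)) : twist n A = map_mx (frob n) A.
Proof. by []. Qed.

End Frobenius.

(** * Absolute values and limits in C *)

Section ValuedField.
Variables (F : finFieldType) (R : realType) (C : valuedExt F R).
Hypothesis hC : is_Cinfty C.
Implicit Types (x y l : C) (f g : pser C).

Lemma cvgCP (x : nat -> C) l : cvg_to_C x l <->
  forall e : R, 0 < e ->
    exists N, forall n, (N <= n)%N -> vabs (x n - l) < e.
Proof.
split=> [/cvgr0Pnorm_lt H e /H [N _ HN]|H].
  exists N => n le_Nn; have := HN n le_Nn.
  by rewrite ger0_norm // vabs_ge0.
apply/cvgr0Pnorm_lt => e /H [N HN]; exists N => // n le_Nn.
by rewrite ger0_norm ?(vabs_ge0 hC) //; apply: HN.
Qed.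

Lemma vabs0 : vabs (0 : C) = 0. Proof. exact/vabs_eq0. Qed.

Lemma vabs1 : vabs (1 : C) = 1.
Proof.
have := vabsM hC 1 1; rewrite mulr1 => /esym/eqP.
rewrite -subr_eq0 -[X in _ - X]mulr1 -mulrBr mulf_eq0 subr_eq0.
case/orP => /eqP // /(vabs_eq0 hC)/eqP; by rewrite oner_eq0.
Qed.

Lemma vabsX x n : vabs (x ^+ n) = vabs x ^+ n.
Proof. by elim: n => [|n IHn]; rewrite ?vabs1 // !exprS vabsM // IHn. Qed.

Lemma vabsN x : vabs (- x) = vabs x.
Proof.
suff N1 : vabs (-1 : C) = 1 by rewrite -mulN1r vabsM // N1 mul1r.
have /eqP : vabs (-1 : C) ^+ 2 = 1 by rewrite -vabsX sqrrN expr1n vabs1.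
by rewrite -[X in _ == X](expr1n _ 2) eqrXn2 ?vabs_ge0 // => /eqP.
Qed.

Lemma vabs_subC x y : vabs (x - y) = vabs (y - x).
Proof. by rewrite -opprB vabsN. Qed.

Lemma vabsV x : vabs x^-1 = (vabs x)^-1.
Proof.
have [->|x0] := eqVneq x 0; first by rewrite invr0 vabs0 invr0.
have vx0 : vabs x != 0 by apply: contra x0 => /eqP/(vabs_eq0 hC) ->.
by apply: (mulfI vx0); rewrite -vabsM // !divff // vabs1.
Qed.

Lemma vabsD_le x y (B : R) : vabs x <= B -> vabs y <= B -> vabs (x + y) <= B.
Proof.
by move=> xB yB; rewrite (le_trans (vabs_ultra hC x y)) // ge_max xB.
Qed.

Lemma vabsD_lt x y (B : R) : vabs x < B -> vabs y < B -> vabs (x + y) < B.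
Proof.
by move=> xB yB; rewrite (le_lt_trans (vabs_ultra hC x y)) // gt_max xB.
Qed.

Lemma vabs_sum_le (I : Type) (s : seq I) (P : pred I) (a : I -> C) (B : R) :
  0 <= B -> (forall i, P i -> vabs (a i) <= B) ->
  vabs (\sum_(i <- s | P i) a i) <= B.
Proof.
move=> B0 aB; elim/big_ind: _ => //; first by rewrite vabs0.
by move=> x y; apply: vabsD_le.
Qed.

(** By the ultrametric inequality; thus the binomial coefficients of the hyperderivatives never
    enlarge a term. *)
Lemma vabsMn_le x n : vabs (x *+ n) <= vabs x.
Proof.
elim: n => [|n IHn]; first by rewrite mulr0n vabs0 vabs_ge0.
by rewrite mulrS vabsD_le.
Qed.

Lemma q_gt1 : 1 < #|F|%:R :> R. Proof. by rewrite ltr1n card_gt1. Qed.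

Lemma theta_neq0 : theta C != 0.
Proof.
apply/eqP => /(congr1 (@vabs _ _ C)); rewrite vabs_theta // vabs0 => /eqP.
by rewrite gt_eqF // (lt_trans ltr01 q_gt1).
Qed.

Lemma vabs_thetaX n : vabs (theta C ^+ n) = #|F|%:R ^+ n.
Proof. by rewrite vabsX vabs_theta. Qed.

Lemma cvgC_unique (x : nat -> C) l l' : cvg_to_C x l -> cvg_to_C x l' -> l = l'.
Proof.
move=> /cvgCP Hl /cvgCP Hl'; apply/eqP; rewrite -subr_eq0.
apply/negPn/negP => ll'; have e0 : 0 < vabs (l - l').
  rewrite lt_neqAle vabs_ge0 // andbT eq_sym; apply: contra ll'.
  by move=> /eqP /(vabs_eq0 hC) ->.
have [N HN] := Hl _ e0; have [N' HN'] := Hl' _ e0.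
have := HN _ (leq_maxl N N'); have := HN' _ (leq_maxr N N').
set z := x _; rewrite (vabs_subC z l) => H1 H2.
have := vabsD_lt H2 H1; by rewrite addrA subrK ltxx.
Qed.

Lemma lim_C_eq (x : nat -> C) l : cvg_to_C x l -> lim_C x = l.
Proof.
move=> xl; rewrite /lim_C; apply: xget_unique => //.
by move=> l' /= /cvgC_unique; apply.
Qed.

Lemma cvgC_cst l : cvg_to_C (fun=> l) l.
Proof. by apply/cvgCP => e e0; exists 0%N => n _; rewrite subrr vabs0. Qed.

Lemma cvgCD (x y : nat -> C) l l' : cvg_to_C x l -> cvg_to_C y l' ->
  cvg_to_C (fun n => x n + y n) (l + l').
Proof.
move=> /cvgCP Hl /cvgCP Hl'; apply/cvgCP => e e0.
have [N HN] := Hl _ e0; have [N' HN'] := Hl' _ e0.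
exists (maxn N N') => n; rewrite geq_max => /andP[/HN H /HN' H'].
by rewrite opprD addrACA vabsD_lt.
Qed.

Lemma cvgCZ (x : nat -> C) l a : cvg_to_C x l ->
  cvg_to_C (fun n => a * x n) (a * l).
Proof.
move=> /cvgCP Hl; have [->|a0] := eqVneq a 0.
  by rewrite mul0r; under eq_fun do rewrite mul0r; apply: cvgC_cst.
have va0 : 0 < vabs a.
  by rewrite lt_neqAle vabs_ge0 // andbT eq_sym; apply: contra a0 =>
    /eqP /(vabs_eq0 hC) ->.
apply/cvgCP => e e0; have [N HN] := Hl _ (divr_gt0 e0 va0).
exists N => n /HN; by rewrite -mulrBr vabsM // ltr_pdivlMr // mulrC.
Qed.

Lemma cvgCN (x : nat -> C) l : cvg_to_C x l -> cvg_to_C (fun n => - x n) (- l).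
Proof.
move=> /(cvgCZ (-1)); rewrite mulN1r.
by under eq_fun do rewrite mulN1r.
Qed.

Lemma cvgC_sum (I : Type) (s : seq I) (x : I -> nat -> C) (l : I -> C) :
  (forall i, cvg_to_C (x i) (l i)) ->
  cvg_to_C (fun n => \sum_(i <- s) x i n) (\sum_(i <- s) l i).
Proof.
move=> xl; elim: s => [|i s IHs].
  by rewrite big_nil; under eq_fun do rewrite big_nil; apply: cvgC_cst.
by rewrite big_cons; under eq_fun do rewrite big_cons; apply: cvgCD.
Qed.

Lemma cvgC_shift (x : nat -> C) l :
  cvg_to_C x l <-> cvg_to_C (fun n => x n.+1) l.
Proof.
split=> /cvgCP H; apply/cvgCP => e /H [N HN].
  by exists N => n le_Nn; apply: HN; rewrite leqW.
by exists N.+1 => -[//|n]; apply: HN.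
Qed.

Lemma cvgC_frob (x : nat -> C) l n :
  cvg_to_C x l -> cvg_to_C (fun i => frob n (x i)) (frob n l).
Proof.
move=> /cvgCP H; apply/cvgCP => e e0.
(* Below 1, raising to the power q^n does not increase absolute values. *)
have [|N HN] := H (Num.min e 1); first by rewrite lt_min e0 ltr01.
exists N => i /HN; rewrite lt_min => /andP[xe x1].
rewrite -rmorphB /frob vabsX; apply: le_lt_trans xe.
rewrite -[leRHS]expr1 ler_wiXn2l ?vabs_ge0 ?(ltW x1) //.
by rewrite expn_gt0 (ltnW (card_gt1 _)).
Qed.

Lemma vabs_lim_le (x : nat -> C) l (B : R) :
  cvg_to_C x l -> (forall n, vabs (x n) <= B) -> vabs l <= B.
Proof.
move=> /cvgCP H xB; rewrite leNgt; apply/negP => Bl.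
have B0 : 0 <= B := le_trans (vabs_ge0 hC _) (xB 0%N).
have [N /(_ N (leqnn N))] := H _ (le_lt_trans B0 Bl).
rewrite vabs_subC => xl; have := vabsD_lt xl (le_lt_trans (xB N) Bl).
by rewrite subrK ltxx.
Qed.

(** A block of consecutive terms is bounded by its largest one, so terms tending to 0 make the
    partial sums Cauchy. *)
Lemma cvg_series_C (a : nat -> C) : cvg_to_C a 0 ->
  exists l, cvg_to_C (fun m => \sum_(j < m) a j) l.
Proof.
move=> /cvgCP H; apply: (vabs_complete hC) => e /H [N HN]; exists N => m n.
wlog le_mn : m n / (m <= n)%N => [Hw Nm Nn|Nm Nn].
  by have [/Hw|/ltnW/Hw] := leqP m n; [|rewrite vabs_subC]; apply.
rewrite vabs_subC -!(big_mkord xpredT a) (big_cat_nat _ le_mn) //= addrAC subrr add0r.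
have e0 : 0 < e.
  by apply: le_lt_trans (HN N (leqnn N)); apply: vabs_ge0.
rewrite big_nat; elim/big_ind: _ => //; first by rewrite vabs0.
  by move=> ? ?; apply: vabsD_lt.
by move=> i /andP[/(leq_trans Nm)/HN]; rewrite subr0.
Qed.

Lemma cvgC_null_le (x : nat -> C) (b : nat -> R) :
  (forall n, vabs (x n) <= b n) -> b n @[n --> \oo] --> (0 : R) ->
  cvg_to_C x 0.
Proof.
move=> xb /cvgr0Pnorm_lt H; apply/cvgCP => e /H [N _ HN].
exists N => n /HN /=; rewrite subr0; apply: le_lt_trans.
exact: le_trans (xb n) (ler_norm _).
Qed.

Lemma cvgC_cauchy_incr (x : nat -> C) : cvg_to_C (fun n => x n.+1 - x n) 0 ->
  exists l, cvg_to_C x l.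
Proof.
move=> /cvg_series_C [l Hl]; exists (l + x 0%N).
have := cvgCD Hl (cvgC_cst (x 0%N)); congr (cvg_to_C _ _); apply/funext => m.
by rewrite -(big_mkord xpredT (fun n => x n.+1 - x n)) telescope_sumr // subrK.
Qed.

End ValuedField.

(** * The Tate algebra and Taylor coefficients at theta *)

Section TateAlgebra.
Variables (F : finFieldType) (R : realType) (C : valuedExt F R).
Hypothesis hC : is_Cinfty C.
Implicit Types (x y l : C) (f g : pser C).

(** The Gauss norm of radius rho, as an upper bound rather than a supremum, so that finiteness need
    not be known beforehand. *)
Definition pnorm_le (rho : R) f (B : R) : Prop :=
  forall j, vabs (f j) * rho ^+ j <= B.

Lemma pnorm_le_ge0 rho f B : pnorm_le rho f B -> 0 <= B.
Proof. by move/(_ 0%N); rewrite mulr1; apply: le_trans; apply: vabs_ge0. Qed.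

Lemma pnorm_le_weak rho f B B' : B <= B' -> pnorm_le rho f B -> pnorm_le rho f B'.
Proof. by move=> BB' fB j; apply: le_trans BB'. Qed.

Lemma pnorm_leD rho f g B : 0 <= rho ->
  pnorm_le rho f B -> pnorm_le rho g B -> pnorm_le rho (f + g) B.
Proof.
move=> rho0 fB gB j.
apply: le_trans (ler_wpM2r (exprn_ge0 j rho0) (vabs_ultra hC _ _)) _.
by rewrite maxr_pMl ?exprn_ge0 // ge_max fB gB.
Qed.

Lemma pnorm_leN rho f B : pnorm_le rho f B -> pnorm_le rho (- f) B.
Proof. by move=> fB j; rewrite pserN vabsN. Qed.

Lemma pnorm_leM rho f g B B' : 0 <= rho ->
  pnorm_le rho f B -> pnorm_le rho g B' -> pnorm_le rho (f * g) (B * B').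
Proof.
move=> rho0 fB gB' j; rewrite pserM.
have [->|rho_neq0] := eqVneq rho 0.
  case: j => [|j]; last first.
    rewrite expr0n /= mulr0.
    by rewrite mulr_ge0 ?(pnorm_le_ge0 fB) ?(pnorm_le_ge0 gB').
  rewrite mulr1 big_ord1 vabsM // ler_pM ?vabs_ge0 //.
    by have := fB 0%N; rewrite mulr1.
  by have := gB' 0%N; rewrite mulr1.
have rhoj : 0 < rho ^+ j by rewrite exprn_gt0 // lt_def rho_neq0.
rewrite -ler_pdivlMr //; apply: vabs_sum_le => //.
  by rewrite divr_ge0 ?mulr_ge0 ?(pnorm_le_ge0 fB) ?(pnorm_le_ge0 gB') ?ltW.
move=> i _; rewrite ler_pdivlMr // vabsM //.
have le_ij : (i <= j)%N by rewrite -ltnS.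
rewrite -[in rho ^+ j](subnKC le_ij) exprD mulrACA.
by rewrite ler_pM // mulr_ge0 ?vabs_ge0 ?exprn_ge0.
Qed.

Lemma pnorm_le_const rho x : 0 <= rho -> pnorm_le rho (pconst x) (vabs x).
Proof.
move=> rho0 [|j]; rewrite /pconst /= ?mulr1 //.
by rewrite vabs0 // mul0r vabs_ge0.
Qed.

Lemma pnorm_le1 rho : 0 <= rho -> pnorm_le rho (1 : pser C) 1.
Proof.
move=> rho0; rewrite -(rmorph1 (@pconst C)) -(vabs1 hC).
exact: pnorm_le_const.
Qed.

Lemma pnorm_leX rho f B n : 0 <= rho ->
  pnorm_le rho f B -> pnorm_le rho (f ^+ n) (B ^+ n).
Proof.
move=> rho0 fB; elim: n => [|n IHn]; first exact: pnorm_le1.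
by rewrite !exprS; apply: pnorm_leM.
Qed.

Lemma pnorm_le_var rho : 0 <= rho -> pnorm_le rho (pvar C) rho.
Proof.
move=> rho0 j; rewrite /pvar; have [->|_] := eqVneq j 1%N.
  by rewrite vabs1 // mul1r.
by rewrite vabs0 // mul0r.
Qed.

(** In the geometric series of 1 / (t - a) the term of index 0 is the largest as long as |t| <=
    |a|. *)
Lemma pnorm_le_invXsub rho a : a != 0 -> 0 <= rho -> rho <= vabs a ->
  pnorm_le rho (ps_invXsub a) (vabs a)^-1.
Proof.
move=> a0 rho0 rho_a j; have va0 : 0 < vabs a.
  rewrite lt_neqAle vabs_ge0 // andbT eq_sym.
  by apply: contra a0 => /eqP/(vabs_eq0 hC) ->.
rewrite /ps_invXsub vabsN // vabsV // vabsX // exprS invfM -mulrA ger_pMr ?invr_gt0 //.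
by rewrite mulrC ler_pdivrMr ?exprn_gt0 // mul1r lerXn2r ?nnegrE ?(ltW va0).
Qed.

(* Convergence for |t| <= q^2.  The partial sums are polynomials in the
   1 / (t - theta^(q^k)) with k >= 1 and q^k >= 2, hence converge there. *)
Definition overconv f : Prop := exists B, pnorm_le (#|F|%:R ^+ 2) f B.

Let q2_ge0 : 0 <= #|F|%:R ^+ 2 :> R. Proof. by rewrite exprn_ge0. Qed.

Lemma overconvD f g : overconv f -> overconv g -> overconv (f + g).
Proof.
move=> [B fB] [B' gB']; exists (Num.max B B').
apply: pnorm_leD => //; [move: fB|move: gB']; apply: pnorm_le_weak;
by rewrite le_max lexx ?orbT.
Qed.

Lemma overconvN f : overconv f -> overconv (- f).
Proof. by move=> [B fB]; exists B; apply: pnorm_leN. Qed.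

Lemma overconvM f g : overconv f -> overconv g -> overconv (f * g).
Proof. by move=> [B fB] [B' gB']; exists (B * B'); apply: pnorm_leM. Qed.

Lemma overconvX f n : overconv f -> overconv (f ^+ n).
Proof. by move=> [B fB]; exists (B ^+ n); apply: pnorm_leX. Qed.

Lemma overconv_const x : overconv (pconst x).
Proof. by exists (vabs x); apply: pnorm_le_const. Qed.

Lemma overconv1 : overconv 1.
Proof. by exists 1; apply: pnorm_le1. Qed.

Lemma overconv0 : overconv 0.
Proof. by rewrite -(rmorph0 (@pconst C)); apply: overconv_const. Qed.

Lemma overconv_var : overconv (pvar C).
Proof. by exists (#|F|%:R ^+ 2); apply: pnorm_le_var. Qed.

Lemma overconv_sum (I : Type) (s : seq I) (P : pred I) (f : I -> pser C) :
  (forall i, P i -> overconv (f i)) -> overconv (\sum_(i <- s | P i) f i).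
Proof.
move=> Hf; elim/big_ind: _ => //; first exact: overconv0.
by move=> ? ?; apply: overconvD.
Qed.

Lemma overconv_inv_bbL n : overconv (inv_bbL C n).
Proof.
elim: n => [|n IHn]; first by rewrite inv_bbL0; apply: overconv1.
rewrite inv_bbLS; apply: overconvM => //.
exists (vabs (theta C ^+ (#|F| ^ n.+1)%N))^-1; apply: pnorm_le_invXsub => //.
  by rewrite expf_neq0 // theta_neq0.
rewrite vabs_thetaX // ler_eXn2l ?q_gt1 // expnS.
by rewrite (leq_trans (card_gt1 F)) // leq_pmulr // expn_gt0 ltnW // card_gt1.
Qed.

Lemma overconv_tLi_factor n w M : overconv (tLi_factor n w M).
Proof.
by apply: overconvM; [apply: overconv_const|apply/overconvX/overconv_inv_bbL].
Qed.

Lemma overconv_tLi_partial (n : seq nat) (w : seq C) M :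
  size n = size w -> overconv (tLi_partial n w M).
Proof.
elim: n w M => [|n1 n IHn] [|w1 w] M //= => [_|[sz]].
  by rewrite tLi_partial_nil; apply: overconv1.
elim: M => [|M IHM]; first by rewrite tLi_partial0; apply: overconv0.
rewrite tLi_partialS; apply: overconvD => //.
by apply: overconvM; [apply: overconv_tLi_factor|apply: IHn].
Qed.

Lemma in_TateP f : in_Tate f <-> forall e : R, 0 < e ->
  exists N, forall j, (N <= j)%N -> vabs (f j) * #|F|%:R ^+ j < e.
Proof.
rewrite /in_Tate cvgCP //; split=> H e /H [N HN]; exists N => j /HN.
  by rewrite subr0 vabsM // vabs_thetaX.
by rewrite subr0 vabsM // vabs_thetaX.
Qed.

(** Passing from radius q^2 to radius q gains a factor q^(-j) at index j. *)
Lemma overconv_in_Tate f : overconv f -> in_Tate f.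
Proof.
move=> [B fB]; rewrite /in_Tate.
have q0 : 0 < #|F|%:R :> R := lt_trans ltr01 (q_gt1 F R).
apply: (@cvgC_null_le _ _ _ hC _ (fun j => B * (#|F|%:R^-1) ^+ j)) => [j|].
  rewrite vabsM // vabs_thetaX // exprVn ler_pdivlMr ?exprn_gt0 //.
  by rewrite -mulrA -exprD addnn -muln2 mulnC exprM.
rewrite -[X in _ --> X](mulr0 B); apply: cvgMr; apply: cvg_expr.
by rewrite ger0_norm ?invr_ge0 ?ler0n // invf_lt1 // q_gt1.
Qed.

Lemma in_TateD f g : in_Tate f -> in_Tate g -> in_Tate (f + g).
Proof.
move=> Hf Hg; have := cvgCD hC Hf Hg; rewrite addr0 /in_Tate.
by congr (cvg_to_C _ _); apply/funext => j; rewrite pserD mulrDl.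
Qed.

Lemma in_TateN f : in_Tate f -> in_Tate (- f).
Proof.
move=> Hf; have := cvgCN hC Hf; rewrite oppr0 /in_Tate.
by congr (cvg_to_C _ _); apply/funext => j; rewrite pserN mulNr.
Qed.

Lemma in_Tate_scale x f : in_Tate f -> in_Tate (pconst x * f).
Proof.
move=> Hf; have := cvgCZ hC x Hf; rewrite mulr0 /in_Tate.
by congr (cvg_to_C _ _); apply/funext => j; rewrite pconstM mulrA.
Qed.

Lemma in_Tate_var f : in_Tate f -> in_Tate (pvar C * f).
Proof.
move=> /(cvgCZ hC (theta C)) Hf; apply/cvgC_shift => //.
rewrite mulr0 in Hf; move: Hf; congr (cvg_to_C _ _); apply/funext => j.
by rewrite pvarM exprS mulrCA.
Qed.

Lemma in_Tate_hyperderiv n f : in_Tate f -> in_Tate (hyperderiv n f).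
Proof.
move=> /in_TateP H; apply/in_TateP => e /H [N HN]; exists N => j le_Nj.
apply: le_lt_trans (HN (j + n)%N (leq_trans le_Nj (leq_addr _ _))).
rewrite /hyperderiv; apply: ler_pM; rewrite ?vabs_ge0 ?exprn_ge0 ?vabsMn_le //.
by rewrite ler_weXn2l ?leq_addr // ltW // q_gt1.
Qed.

(** For f in T_theta, the Taylor coefficient of order k at t = theta. *)
Definition jet (k : nat) f : C := eval_theta (hyperderiv k f).

(** On T_theta the terms f_j theta^j tend to 0, so [eval_theta] is a true limit and not the default
    value of [lim_C]. *)
Lemma cvg_eval_theta f : in_Tate f ->
  cvg_to_C (fun m => \sum_(j < m) f j * theta C ^+ j) (eval_theta f).
Proof.
by move=> /(cvg_series_C hC) [l Hl]; rewrite /eval_theta (lim_C_eq hC Hl).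
Qed.

Lemma eval_theta_eq f l :
  cvg_to_C (fun m => \sum_(j < m) f j * theta C ^+ j) l -> eval_theta f = l.
Proof. exact: lim_C_eq. Qed.

Lemma cvg_jet k f : in_Tate f ->
  cvg_to_C (fun m => \sum_(j < m) hyperderiv k f j * theta C ^+ j) (jet k f).
Proof. by move=> Hf; apply/cvg_eval_theta/in_Tate_hyperderiv. Qed.

Lemma jetD k f g : in_Tate f -> in_Tate g -> jet k (f + g) = jet k f + jet k g.
Proof.
move=> /(cvg_jet k) Hf /(cvg_jet k) Hg; apply: eval_theta_eq.
have := cvgCD hC Hf Hg; congr (cvg_to_C _ _); apply/funext => m.
by rewrite -big_split /=; apply: eq_bigr => j _; rewrite /hyperderiv pserD mulrnDl mulrDl.
Qed.

Lemma jet_scale k x f : in_Tate f -> jet k (pconst x * f) = x * jet k f.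
Proof.
move=> /(cvg_jet k) Hf; apply: eval_theta_eq.
have := cvgCZ hC x Hf; congr (cvg_to_C _ _); apply/funext => m.
rewrite big_distrr /=; apply: eq_bigr => j _.
by rewrite /hyperderiv pconstM /= mulrA mulrnAr.
Qed.

Lemma jetN k f : in_Tate f -> jet k (- f) = - jet k f.
Proof.
move=> Hf; rewrite -mulN1r -(rmorphN1 (@pconst C)) jet_scale // mulN1r //.
Qed.

Lemma jet0 k : jet k 0 = 0.
Proof.
have := @jet_scale k 0 1 (overconv_in_Tate overconv1).
by rewrite rmorph0 !mul0r.
Qed.

Lemma eval_theta_var f : in_Tate f ->
  cvg_to_C (fun m => \sum_(j < m) (pvar C * f) j * theta C ^+ j)
    (theta C * eval_theta f).
Proof.
move=> /cvg_eval_theta /(cvgCZ hC (theta C)) Hf; apply/cvgC_shift => //.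
move: Hf; congr (cvg_to_C _ _); apply/funext => m.
rewrite big_ord_recl pvarM mul0r add0r big_distrr /=; apply: eq_bigr => j _.
by rewrite pvarM /= exprS mulrCA.
Qed.

Lemma jet0_var f : in_Tate f -> jet 0 (pvar C * f) = theta C * jet 0 f.
Proof.
have hyp0 g : hyperderiv 0 g = g.
  by apply/funext => j; rewrite /hyperderiv addn0 bin0.
by move=> Hf; rewrite /jet !hyp0; apply/eval_theta_eq/eval_theta_var.
Qed.

(** Leibniz rule for multiplication by t, from Pascal's identity; the summand [jet k f] is what the
    superdiagonal of N produces. *)
Lemma jetS_var k f : in_Tate f ->
  jet k.+1 (pvar C * f) = theta C * jet k.+1 f + jet k f.
Proof.
move=> Hf; apply: eval_theta_eq.
have := cvgCD hC (eval_theta_var (in_Tate_hyperderiv k.+1 Hf)) (cvg_jet k Hf).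
congr (cvg_to_C _ _); apply/funext => m.
rewrite -big_split /=; apply: eq_bigr => j _; rewrite -mulrDl; congr (_ * _).
rewrite /hyperderiv !pvarM addnS; case: j => -[|j] _ /=.
  by rewrite add0r !add0n !binn.
by rewrite !addnS !addSn -mulrnDr -binS.
Qed.

(** Binomial coefficients have absolute value at most 1 and dropping k powers of theta only shrinks
    a term. This bound is the continuity of J. *)
Lemma vabs_jet_le k f B : in_Tate f -> pnorm_le #|F|%:R f B -> vabs (jet k f) <= B.
Proof.
move=> Hf fB; apply: (vabs_lim_le hC (cvg_jet k Hf)) => m.
apply: vabs_sum_le => //; first exact: pnorm_le_ge0 fB.
move=> j _; apply: le_trans (fB (j + k)%N); rewrite vabsM // vabs_thetaX //.
apply: ler_pM; rewrite ?vabs_ge0 ?exprn_ge0 ?vabsMn_le //.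
by rewrite ler_weXn2l ?leq_addr // ltW // q_gt1.
Qed.

Lemma pnorm_leP f B : pnorm_le #|F|%:R f B <->
  forall j, vabs (f j * theta C ^+ j) <= B.
Proof.
by split=> fB j; move: (fB j); rewrite vabsM // vabs_thetaX.
Qed.

End TateAlgebra.

(** * Convergence of the polylogarithms *)

Section Convergence.
Variables (F : finFieldType) (R : realType) (C : valuedExt F R).
Hypothesis hC : is_Cinfty C.
Implicit Types (f g : pser C).

Notation q := #|F|%:R.

Let q_ge0 : 0 <= q :> R. Proof. exact: ler0n. Qed.
Let q_gt0 : 0 < q :> R. Proof. exact: lt_trans ltr01 (q_gt1 F R). Qed.

(** The limit is taken coefficient by coefficient. By the ultrametric inequality K c^M bounds
    S_(m+M) - S_M uniformly in m, and this bound survives in the limit. *)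
Lemma cvg_geometric_Tate (S : nat -> pser C) (K c : R) :
  0 <= c < 1 -> (forall M, in_Tate (S M)) ->
  (forall M, pnorm_le q (S M.+1 - S M) (K * c ^+ M)) ->
  exists f : pser C, cvg_to_Tate S f.
Proof.
move=> /andP[c0 c1] ST dS.
have K0 : 0 <= K by have := pnorm_le_ge0 hC (dS 0%N); rewrite mulr1.
have Kc0 : K * c ^+ M @[M --> \oo] --> (0 : R).
  by rewrite -[X in _ --> X](mulr0 K); apply: cvgMr; apply: cvg_expr; rewrite ger0_norm.
have Sj j : exists l, cvg_to_C (fun M => S M j) l.
  apply: (cvgC_cauchy_incr hC); apply: (cvgC_null_le hC) Kc0 => M.
  apply: le_trans (dS M j); rewrite ler_peMr ?vabs_ge0 // exprn_ege1 //.
  exact/ltW/q_gt1.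
have [f Hf] := choice Sj.
have fS M : pnorm_le q (f - S M : pser C) (K * c ^+ M).
  move=> j; rewrite -ler_pdivlMr ?exprn_gt0 //.
  have Hm : cvg_to_C (fun m => S (m + M)%N j - S M j) (f j - S M j).
    apply: cvgCD => //; last exact: cvgC_cst.
    have := Hf j; move/(cvgCP hC) => H; apply/(cvgCP hC) => e /H [N HN].
    by exists N => n le_Nn; apply: HN; rewrite (leq_trans le_Nn) // leq_addr.
  apply: (vabs_lim_le hC Hm) => m; rewrite ler_pdivlMr ?exprn_gt0 //.
  suff : pnorm_le q (S (m + M)%N - S M) (K * c ^+ M) by apply.
  elim: m => [|m IHm].
    by rewrite subrr => i; rewrite vabs0 // mul0r mulr_ge0 // exprn_ge0.
  rewrite -(subrK (S (m + M)%N) (S (m.+1 + M)%N)) -addrA.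
  apply: pnorm_leD => //; apply: pnorm_le_weak (dS _).
  by rewrite ler_wpM2l // ler_wiXn2l ?(ltW c1) // leq_addl.
(* f lies in T_theta because it is uniformly close to some S_M that does. *)
exists f; split.
  apply/(in_TateP hC) => e e0; have /cvgr0Pnorm_lt/(_ _ e0) [M _ HM] := Kc0.
  have /(in_TateP hC)/(_ _ e0) [N HN] := ST M; exists N => j /HN SMj.
  rewrite -(subrK (S M j) (f j)).
  apply: (@le_lt_trans _ _ (Num.max (vabs (f j - S M j)) (vabs (S M j)) * q ^+ j)).
    by rewrite ler_pM2r ?exprn_gt0 //; apply: vabs_ultra.
  rewrite maxr_pMl ?exprn_ge0 // gt_max SMj andbT.
  apply: le_lt_trans (fS M j) _; apply: le_lt_trans (ler_norm _) (HM M _).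
  exact: leqnn.
move=> e e0; have /cvgr0Pnorm_lt/(_ _ e0) [N _ HN] := Kc0.
exists N => // M /HN lt_e j; apply/ltW; apply: le_lt_trans _ lt_e.
apply: le_trans (ler_norm _).
have := fS M j; rewrite vabsM // vabs_thetaX // vabs_subC //.
Qed.

Lemma lim_TateP (S : nat -> pser C) f :
  cvg_to_Tate S f -> cvg_to_Tate S (lim_Tate S).
Proof.
by move=> Sf; apply: (@xgetPex _ (fun=> 0) (cvg_to_Tate S)); exists f.
Qed.

Lemma cvg_jet_Tate k (S : nat -> pser C) f : (forall M, in_Tate (S M)) ->
  cvg_to_Tate S f -> cvg_to_C (fun M => jet k (S M)) (jet k f).
Proof.
move=> ST [fT Sf]; apply/(cvgCP hC) => e e0.
(* [cvg_to_Tate] yields a weak inequality; e / 2 makes it strict. *)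
have [|N _ HN] := Sf (e / 2); first by rewrite divr_gt0.
exists N => M /HN le_e; have SfT : in_Tate (S M - f).
  by apply: in_TateD => //; apply: in_TateN.
have -> : jet k (S M) - jet k f = jet k (S M - f).
  by rewrite jetD ?jetN //; apply: in_TateN.
apply: (@le_lt_trans _ _ (e / 2)); last by rewrite ltr_pdivrMr // ltr_pMr // ltr1n.
by apply: vabs_jet_le => //; apply/pnorm_leP.
Qed.

(** The radius for weight 1. It satisfies kappa^q = kappa q^q, because q * (q / (q - 1)) = q / (q -
    1) + q. *)
Definition kappa : R := q `^ (q / (q - 1)).

Lemma kappa_gt0 : 0 < kappa. Proof. exact: powR_gt0. Qed.

Lemma polylog_radiusE n : polylog_radius F R n = kappa ^+ n.
Proof.
rewrite /polylog_radius -powR_mulrn ?powR_ge0 // -powRrM.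
by rewrite [in RHS]mulrC mulrA.
Qed.

Lemma kappaX M : kappa ^+ (#|F| ^ M.+1) = kappa ^+ (#|F| ^ M) * q ^+ (#|F| ^ M.+1).
Proof.
have kq : kappa ^+ #|F| = kappa * q ^+ #|F|.
  rewrite -[q ^+ _]powR_mulrn // -powR_mulrn ?powR_ge0 // -powRrM -powRD.
    congr (_ `^ _); have q1 : q - 1 != 0 :> R by rewrite subr_eq0 gt_eqF ?q_gt1.
    by field.
  by rewrite (gt_eqF q_gt0) implybT.
rewrite expnS exprM kq exprMn -exprM //.
Qed.

(** kappa^(1 - q^M) equals q^(-(q + q^2 + ... + q^M)), the product of the |theta^(q^k)|^(-1) for 1
    <= k <= M. *)
Lemma pnorm_le_inv_bbL M : pnorm_le q (inv_bbL C M) (kappa / kappa ^+ (#|F| ^ M)).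
Proof.
have k0 := kappa_gt0.
elim: M => [|M IHM].
  by rewrite inv_bbL0 expr1 divff ?gt_eqF //; apply: pnorm_le1.
rewrite inv_bbLS kappaX invfM mulrA -(vabs_thetaX hC); apply: pnorm_leM => //.
apply: pnorm_le_invXsub => //; first by rewrite expf_neq0 // theta_neq0.
rewrite vabs_thetaX // -[leLHS]expr1 ler_weXn2l ?(ltW (q_gt1 F R)) //.
by rewrite expn_gt0 ltnW // card_gt1.
Qed.

(** The form of the bound displays the radius: for |w| <= kappa^n the factors stay bounded, and for
    |w| < kappa^n they decay. *)
Lemma pnorm_le_tLi_factor n (w : C) M : pnorm_le q (tLi_factor n w M)
  (kappa ^+ n * (vabs w / kappa ^+ n) ^+ (#|F| ^ M)).
Proof.
have -> : kappa ^+ n * (vabs w / kappa ^+ n) ^+ (#|F| ^ M) =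
    vabs (w ^+ (#|F| ^ M)) * (kappa / kappa ^+ (#|F| ^ M)) ^+ n.
  rewrite vabsX // [in LHS]exprMn [in RHS]exprMn !exprVn -!exprM [(n * _)%N]mulnC.
  by rewrite mulrCA.
by apply: pnorm_leM => //; [apply: pnorm_le_const|apply/pnorm_leX/pnorm_le_inv_bbL].
Qed.

(** On the closed discs every factor is at most kappa^n, and the ultrametric inequality keeps sums
    below the same bound. The inner sums enter [cvg_tLi] through this boundedness. *)
Lemma tLi_partial_bounded (n : seq nat) (w : seq C) :
  size n = size w ->
  (forall a, (a < size n)%N -> vabs w`_a <= polylog_radius F R (nth 0%N n a)) ->
  exists B, forall M, pnorm_le q (tLi_partial n w M) B.
Proof.
elim: n w => [|n1 n IHn] [|w1 w] //= => [_ _|[sz] Hw].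
  by exists 1 => M; rewrite tLi_partial_nil; apply: pnorm_le1.
have [a lt_an|B HB] := IHn w sz; first exact: (Hw a.+1).
have k0 : 0 < kappa ^+ n1 by rewrite exprn_gt0 // kappa_gt0.
exists (kappa ^+ n1 * B); elim=> [|M IHM].
  rewrite tLi_partial0 => j; rewrite vabs0 // mul0r.
  by rewrite mulr_ge0 ?(ltW k0) ?(pnorm_le_ge0 hC (HB 0%N)).
rewrite tLi_partialS; apply: pnorm_leD => //; apply: pnorm_leM => //.
apply: pnorm_le_weak (pnorm_le_tLi_factor _ _ _).
have := Hw 0%N isT; rewrite /= polylog_radiusE => w1_le.
rewrite ger_pMr // exprn_ile1 ?divr_ge0 ?vabs_ge0 ?(ltW k0) //.
by rewrite ler_pdivrMr // mul1r.
Qed.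

Lemma in_Tate_tLi_partial (n : seq nat) (w : seq C) M :
  size n = size w -> in_Tate (tLi_partial n w M).
Proof. by move=> sz; apply/(overconv_in_Tate hC)/overconv_tLi_partial. Qed.

(** The strict inequality on the outermost argument makes the increments decay geometrically, while
    the inner sums stay bounded. *)
Lemma cvg_tLi (n1 : nat) (n : seq nat) (w1 : C) (w : seq C) :
  size n = size w -> vabs w1 < polylog_radius F R n1 ->
  (forall a, (a < size n)%N -> vabs w`_a <= polylog_radius F R (nth 0%N n a)) ->
  cvg_to_Tate (tLi_partial (n1 :: n) (w1 :: w)) (tLi (n1 :: n) (w1 :: w)).
Proof.
move=> sz w1_lt Hw; have [B HB] := tLi_partial_bounded sz Hw.
have k0 : 0 < kappa ^+ n1 by rewrite exprn_gt0 // kappa_gt0.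
pose c := vabs w1 / kappa ^+ n1.
have c0 : 0 <= c by rewrite divr_ge0 ?vabs_ge0 ?ltW.
have c1 : c < 1 by rewrite ltr_pdivrMr // mul1r -polylog_radiusE.
have [|M|M|f] := @cvg_geometric_Tate
    (tLi_partial (n1 :: n) (w1 :: w)) (kappa ^+ n1 * B) c; last exact: lim_TateP.
- by rewrite c0.
- by apply: in_Tate_tLi_partial; rewrite /= sz.
rewrite tLi_partialS addrAC subrr add0r [X in pnorm_le _ _ X]mulrAC.
apply: pnorm_leM => //; apply: pnorm_le_weak (pnorm_le_tLi_factor _ _ _).
(* c^(q^M) <= c^M, since M <= q^M and 0 <= c < 1. *)
rewrite ler_wpM2l ?(ltW k0) // ler_wiXn2l ?(ltW c1) //.
exact/ltnW/ltn_expl/card_gt1.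
Qed.

Lemma jet1 k : jet k (1 : pser C) = (k == 0%N)%:R.
Proof.
apply: eval_theta_eq => //; apply/cvgC_shift => //.
have := cvgC_cst hC ((k == 0%N)%:R : C).
congr (cvg_to_C _ _); apply/funext => m; rewrite big_ord_recl big1 => [|j _].
  rewrite /hyperderiv add0n binn addr0 mulr1.
  by rewrite -(rmorph1 (@pconst C)) /pconst; case: k.
by rewrite -(rmorph1 (@pconst C)) /hyperderiv /pconst /= mul0rn mul0r.
Qed.

Lemma theta_frob_neq0 k : theta C - theta C ^+ (#|F| ^ k.+1)%N != 0.
Proof.
rewrite subr_eq0; apply/eqP => /(congr1 (@vabs _ _ C)) /eqP.
rewrite vabs_thetaX // vabs_theta // -[X in X == _]expr1 lt_eqF //.
by rewrite ltr_eXn2l ?q_gt1 // -[X in (X < _)%N](expn0 #|F|) ltn_exp2l ?card_gt1.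
Qed.

Lemma jet0_Xsub a f : in_Tate f ->
  jet 0 ((pvar C - pconst a) * f) = (theta C - a) * jet 0 f.
Proof.
move=> fT; have aT := in_Tate_scale hC a fT.
rewrite mulrBl jetD ?jetN ?jet0_var ?jet_scale ?mulrBl //.
  exact: in_Tate_var.
exact: in_TateN.
Qed.

Lemma jetS_Xsub a k f : in_Tate f ->
  jet k.+1 ((pvar C - pconst a) * f) = (theta C - a) * jet k.+1 f + jet k f.
Proof.
move=> fT; have aT := in_Tate_scale hC a fT.
rewrite mulrBl jetD ?jetN ?jetS_var ?jet_scale ?mulrBl 1?addrAC //.
  exact: in_Tate_var.
exact: in_TateN.
Qed.

Lemma inv_bbLK M : (pvar C - pconst (theta C ^+ (#|F| ^ M.+1)%N)) *
  (inv_bbL C M.+1 : pser C) = inv_bbL C M.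
Proof.
by rewrite inv_bbLS mulrCA ps_invXsubK ?mulr1 // expf_neq0 // theta_neq0.
Qed.

(** Multiplication by t - theta^(q^k) multiplies the value at theta by theta - theta^(q^k), which is
    nonzero for k >= 1; so undoing it divides the value. *)
Lemma jet0_inv_bbL M n f : overconv f ->
  jet 0 ((inv_bbL C M : pser C) ^+ n * f) = jet 0 f / Lfactor C M ^+ n.
Proof.
move=> fo.
have inv1 g : overconv g -> jet 0 ((inv_bbL C M : pser C) * g) = jet 0 g / Lfactor C M.
  move=> go; elim: M => [|M IHM].
    by rewrite inv_bbL0 mul1r /Lfactor big_geq // divr1.
  rewrite /Lfactor big_nat_recr //= invfM mulrA -IHM -(inv_bbLK M) -mulrA jet0_Xsub.
    by rewrite [RHS]mulrC mulKf // theta_frob_neq0.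
  by apply/(overconv_in_Tate hC)/overconvM => //; apply: overconv_inv_bbL.
elim: n => [|n IHn]; first by rewrite mul1r divr1.
rewrite exprS -mulrA inv1 ?IHn; first by rewrite exprSr invfM mulrA.
by apply: overconvM => //; apply/overconvX/overconv_inv_bbL.
Qed.

Lemma jet0_tLi_partial (n : seq nat) (w : seq C) M : size n = size w ->
  jet 0 (tLi_partial n w M) = Li_partial n w M.
Proof.
elim: n w M => [|n1 n IHn] [|w1 w] M //= => [_|[sz]].
  by rewrite tLi_partial_nil Li_partial_nil jet1.
elim: M => [|M IHM]; first by rewrite tLi_partial0 Li_partial0 jet0.
have To := overconv_tLi_partial hC M.+1 sz.
rewrite tLi_partialS jetD //.
- rewrite IHM Li_partialS /tLi_factor /Li_factor -mulrA jet_scale //.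
    by rewrite jet0_inv_bbL // IHn // mulrA mulrAC.
  apply/(overconv_in_Tate hC)/overconvM => //.
  exact/overconvX/overconv_inv_bbL.
- by apply: in_Tate_tLi_partial; rewrite /= sz.
by apply/(overconv_in_Tate hC)/overconvM => //; apply: overconv_tLi_factor.
Qed.

End Convergence.

(** * Twisted power series *)

Section TwistedSeries.
Variables (F : finFieldType) (R : realType) (C : valuedExt F R).
Variable d : nat.
Implicit Types (a b c e l : nat -> 'M[C]_d) (z y : 'cV[C]_d).

Lemma twistM n k m p (A : 'M[C]_(k, m)) (B : 'M[C]_(m, p)) :
  twist n (A *m B) = twist n A *m twist n B.
Proof. by rewrite !twistE map_mxM. Qed.

Lemma twistD n m (k : nat) (A B : 'M[C]_(k, m)) :
  twist n (A + B) = twist n A + twist n B.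
Proof. by rewrite !twistE map_mxD. Qed.

Lemma twist_sum n m k (I : Type) (s : seq I) (P : pred I) (A : I -> 'M[C]_(k, m)) :
  twist n (\sum_(i <- s | P i) A i) = \sum_(i <- s | P i) twist n (A i).
Proof. by rewrite twistE raddf_sum. Qed.

Lemma twist0 n m k : twist n (0 : 'M[C]_(k, m)) = 0.
Proof. by rewrite twistE map_mx0. Qed.

Lemma twist_scalar n m x : twist n (x%:M : 'M[C]_m) = (frob n x)%:M.
Proof. by rewrite twistE map_scalar_mx. Qed.

Lemma twist0E m k (A : 'M[C]_(k, m)) : twist 0 A = A.
Proof. by apply/matrixP => i j; rewrite mxE expr1. Qed.

Lemma twist_twist i j m k (A : 'M[C]_(k, m)) : twist i (twist j A) = twist (i + j) A.
Proof. by apply/matrixP => x y; rewrite !mxE -exprM expnD mulnC. Qed.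

Lemma tw_mulA a b c : tw_mul (tw_mul a b) c = tw_mul a (tw_mul b c).
Proof.
apply/funext => n; rewrite /tw_mul.
transitivity (\sum_(k < n.+1) \sum_(i < n.+1 | (k <= i)%N)
    a k *m twist k (b (i - k)%N) *m twist i (c (n - i)%N)).
  under eq_bigr => i _.
    rewrite mulmx_suml.
    rewrite (big_ord_widen _ (fun k => a k *m twist k (b (i - k)%N) *m
      twist i (c (n - i)%N)) (ltn_ord i)).
    over.
  by rewrite (exchange_big_dep xpredT).
apply: eq_bigr => k _; rewrite twist_sum mulmx_sumr.
have le_kn : (k <= n)%N by rewrite -ltnS.
pose G i := a k *m twist k (b (i - k)%N) *m twist i (c (n - i)%N).
transitivity (\sum_(0 + k <= i < n.+1) G i).
  by rewrite add0n [RHS](@big_nat_widenl _ _ _ k 0%N) // [RHS]big_mkord.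
rewrite big_addn big_mkord subSn //; apply: eq_bigr => j _.
rewrite /G addnK twistM twist_twist mulmxA addnC.
by rewrite -subnDA.
Qed.

Lemma tw_mul1l a : tw_mul (tw_one C d) a = a.
Proof.
apply/funext => n; rewrite /tw_mul big_ord_recl big1 => [|i _].
  by rewrite /tw_one /= mul1mx twist0E subn0 addr0.
by rewrite /tw_one /= mul0mx.
Qed.

Lemma tw_mul1r a : tw_mul a (tw_one C d) = a.
Proof.
apply/funext => n; rewrite /tw_mul big_ord_recr big1 => [|i _] /=.
  by rewrite /tw_one subnn /= twist_scalar rmorph1 mulmx1 add0r.
by rewrite /tw_one subn_eq0 leqNgt ltn_ord /= twist0 mulmx0.
Qed.

(* The twisted polynomial A + E tau. *)
Definition tw_lin (A E : 'M[C]_d) : nat -> 'M[C]_d :=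
  fun n => if n is n'.+1 then if n' is 0%N then E else 0 else A.

(* An exponential intertwines A with A + E tau; hence its inverse intertwines
   A + E tau with A. *)
Lemma log_recursion (A E : 'M[C]_d) e l : is_Log e l ->
  tw_mul e (tw_lin A 0) = tw_mul (tw_lin A E) e ->
  forall n, l n.+1 *m twist n.+1 A + l n *m twist n E = A *m l n.+1.
Proof.
move=> [/funext el /funext le] eAE n.
have lAE : tw_mul l (tw_lin A E) = tw_mul (tw_lin A 0) l.
  (* l (A + E tau) = l (A + E tau) e l = l e A l = A l. *)
  rewrite -[LHS]tw_mul1r -el [LHS]tw_mulA -(tw_mulA _ e l) -eAE.
  by rewrite tw_mulA -tw_mulA le tw_mul1l.
have -> : A *m l n.+1 = tw_mul (tw_lin A 0) l n.+1.
  rewrite /tw_mul big_ord_recl big1 => [|[[|i] lt_i] _] /=.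
  - by rewrite addr0 subn0 twist0E.
  - by rewrite mul0mx.
  - by rewrite mul0mx.
rewrite -lAE /tw_mul.
rewrite 2!big_ord_recr big1 => [|i _] /=.
  by rewrite subnn subSnn add0r addrC.
have lt_in := ltn_ord i; rewrite subSn ?(ltnW lt_in) //.
case E1: (n - i)%N => [|k]; last by rewrite twist0 mulmx0.
by move/eqP: E1; rewrite subn_eq0 leqNgt lt_in.
Qed.

End TwistedSeries.

(** * Identity theorem for series in q-powers *)

Section IdentityTheorem.
Variables (F : finFieldType) (R : realType) (C : valuedExt F R).
Hypothesis hC : is_Cinfty C.

Lemma cvgC_bounded (x : nat -> C) l :
  cvg_to_C x l -> exists B, forall n, vabs (x n) <= B.
Proof.
move=> /(cvgCP hC)/(_ _ ltr01) [N HN].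
exists (\sum_(n < N) vabs (x n) + (vabs l + 1)) => n.
have s_ge0 : 0 <= \sum_(n < N) vabs (x n) by apply: sumr_ge0 => i _; apply: vabs_ge0.
have [lt_nN|/HN le_Nn] := ltnP n N.
  rewrite (bigD1 (Ordinal lt_nN)) //= -!addrA lerDl !addr_ge0 ?vabs_ge0 //.
  by apply: sumr_ge0 => i _; apply: vabs_ge0.
rewrite -[leLHS]add0r lerD // -(subrK l (x n)) vabsD_le //.
  by rewrite (le_trans (ltW le_Nn)) // lerDr vabs_ge0.
by rewrite lerDl.
Qed.

(** Once the lower coefficients vanish, the n-th term is minus the tail; at small arguments the tail
    is too small unless c_n = 0. *)
Lemma frob_series_eq0 (c : nat -> C) :
  (forall x, cvg_to_C (fun n => \sum_(i < n) c i * frob i x) 0) ->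
  forall n, c n = 0.
Proof.
move=> Hc; have [B cB] : exists B, forall n, vabs (c n) <= B.
  (* At x = 1 the increments of the partial sums are the c_n. *)
  have H1 := Hc 1; apply: (@cvgC_bounded _ (0 - 0)).
  have := cvgCD hC (proj1 (cvgC_shift hC _ _) H1) (cvgCN hC H1).
  congr (cvg_to_C _ _); first apply/funext => n; rewrite ?oppr0 ?addr0 //.
  by rewrite big_ord_recr /= addrAC subrr add0r rmorph1 mulr1.
have B0 : 0 <= B := le_trans (vabs_ge0 hC _) (cB 0%N).
move=> n; elim/ltn_ind: n => n IHn.
have q0 : 0 < #|F|%:R :> R := lt_trans ltr01 (q_gt1 F R).
(* Letting k grow forces c_n = 0, since q^k >= k eventually exceeds B / |c_n|. *)
suff le_k k : vabs (c n) * #|F|%:R ^+ k <= B.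
  apply/(vabs_eq0 hC)/eqP; rewrite eq_le vabs_ge0 // andbT leNgt; apply/negP => c0.
  pose k := (Num.truncn (B / vabs (c n))).+1.
  have : B < vabs (c n) * k%:R by rewrite mulrC -ltr_pdivrMr // truncnS_gt.
  rewrite ltNge (le_trans _ (le_k k)) // ler_pM2l // -natrX ler_nat.
  exact/ltnW/ltn_expl/card_gt1.
(* At x = theta^(-k) the term of index n dominates all later ones. *)
pose x := theta C ^- k.
have vx : vabs x = #|F|%:R ^- k by rewrite vabsV // vabs_thetaX.
have vx0 : 0 < vabs x by rewrite vx invr_gt0 exprn_gt0.
have vx1 : vabs x <= 1 by rewrite vx invf_le1 ?exprn_gt0 // exprn_ege1 // ltW // q_gt1.
have lim_cx : cvg_to_C (fun m => \sum_(n.+1 <= i < m + n.+1) c i * frob i x)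
    (0 - c n * frob n x).
  have := cvgCD hC (Hc x) (cvgC_cst hC (- (c n * frob n x))).
  move/(cvgCP hC) => H; apply/(cvgCP hC) => e /H [N HN].
  exists N => m le_Nm; have := HN (m + n.+1)%N (leq_trans le_Nm (leq_addr _ _)).
  congr (vabs (_ - _) < e); rewrite -(big_mkord xpredT (fun i => c i * frob i x)).
  rewrite (big_cat_nat (n := n.+1)) ?leq_addl //= big_nat_recr //= big_nat big1.
    by rewrite add0r addrAC subrr add0r.
  by move=> i lt_in; rewrite IHn // mul0r.
have := vabs_lim_le hC lim_cx (B := B * vabs x ^+ (#|F| ^ n.+1)).
rewrite sub0r vabsN // vabsM // vabsX // => le_cx.
have {le_cx} : vabs (c n) * vabs x ^+ (#|F| ^ n) <= B * vabs x ^+ (#|F| ^ n.+1).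
  apply: le_cx => m; rewrite big_nat; apply: vabs_sum_le => //.
    by rewrite mulr_ge0 // exprn_ge0 // ltW.
  move=> i /andP[le_ni _]; rewrite vabsM // vabsX //.
  apply: ler_pM; rewrite ?vabs_ge0 ?exprn_ge0 ?(ltW vx0) //.
  by apply: ler_wiXn2l; rewrite ?(ltW vx0) // leq_exp2l // card_gt1.
have lt_n : (#|F| ^ n < #|F| ^ n.+1)%N by rewrite ltn_exp2l ?card_gt1.
(* As q^n < q^(n+1), cancelling |x|^(q^n) leaves at least one factor |x| on the right. *)
rewrite -(subnKC lt_n) addSnnS exprD mulrCA [X in X <= _]mulrC ler_pM2l ?exprn_gt0 //.
move=> le_c; have {le_c} : vabs (c n) <= B * vabs x.
  apply: le_trans le_c _; rewrite ler_wpM2l //.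
  by rewrite -[leRHS]expr1 ler_wiXn2l // ltW.
by rewrite vx ler_pdivlMr ?exprn_gt0.
Qed.

End IdentityTheorem.

(** * From the functional equation of Exp to its coefficients *)

Section Exponential.
Variables (F : finFieldType) (R : realType) (C : valuedExt F R).
Hypothesis hC : is_Cinfty C.
Variable d : nat.
Implicit Types (x : nat -> 'cV[C]_d) (y z : 'cV[C]_d).

Lemma cvg_vecD x x' y y' : cvg_to_vec x y -> cvg_to_vec x' y' ->
  cvg_to_vec (fun n => x n + x' n) (y + y').
Proof.
move=> xy xy' a; rewrite mxE; under eq_fun do rewrite mxE; exact: cvgCD.
Qed.

Lemma cvg_vecN x y : cvg_to_vec x y -> cvg_to_vec (fun n => - x n) (- y).
Proof.
move=> xy a; rewrite mxE; under eq_fun do rewrite mxE; exact: cvgCN.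
Qed.

Lemma cvg_vec_mulmx (A : 'M[C]_d) x y : cvg_to_vec x y ->
  cvg_to_vec (fun n => A *m x n) (A *m y).
Proof.
move=> xy a; rewrite mxE; under eq_fun do rewrite mxE.
by apply: cvgC_sum => // b; apply: cvgCZ.
Qed.

Lemma cvg_vec_twist m x y : cvg_to_vec x y ->
  cvg_to_vec (fun n => twist m (x n)) (twist m y).
Proof.
move=> xy a; rewrite twistE mxE; under eq_fun do rewrite twistE mxE.
exact: cvgC_frob.
Qed.

Lemma cvg_vec_shift x y : cvg_to_vec x y <-> cvg_to_vec (fun n => x n.+1) y.
Proof. by split=> xy a; apply/(cvgC_shift hC (fun n => x n a 0))/xy. Qed.

(** Evaluating at x times a basis vector isolates a column of D, whose entries fall under the scalar
    identity theorem. *)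
Lemma tw_sum_eq0 (D : nat -> 'M[C]_d) : (forall z, tw_sum D z 0) ->
  forall n, D n = 0.
Proof.
move=> Dz n; apply/matrixP => a b; rewrite [RHS]mxE.
apply: (@frob_series_eq0 _ _ _ hC (fun i => D i a b)) => x.
have := Dz (x *: delta_mx b 0) a; rewrite mxE.
congr (cvg_to_C _ _); apply/funext => m; rewrite summxE; apply: eq_bigr => i _.
rewrite mxE (bigD1 b) //= big1 ?addr0 => [|c c_b]; rewrite twistE !mxE.
  by rewrite !eqxx mulr1.
by rewrite (negPf c_b) mulr0 rmorph0 mulr0.
Qed.

(** The functional equation concerns values; the identity theorem turns it into an equality of
    coefficients. *)
Lemma exp_intertwine (A E : 'M[C]_d) (e : nat -> 'M[C]_d) :
  (forall z, exists y, tw_sum e z y) ->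
  (forall z y, tw_sum e z y -> tw_sum e (A *m z) (A *m y + E *m twist 1 y)) ->
  tw_mul e (tw_lin A 0) = tw_mul (tw_lin A E) e.
Proof.
move=> e_cvg e_fun.
have lhsE n : tw_mul e (tw_lin A 0) n = e n *m twist n A.
  rewrite /tw_mul big_ord_recr big1 => [|i _] /=; first by rewrite subnn add0r.
  case E1: (n - i)%N => [|k].
    by move/eqP: E1; rewrite subn_eq0 leqNgt ltn_ord.
  by rewrite /=; case: k E1 => *; rewrite twist0 mulmx0.
have rhsE n : tw_mul (tw_lin A E) e n =
    A *m e n + (if n is m.+1 then E *m twist 1 (e m) else 0).
  rewrite /tw_mul big_ord_recl /= subn0 twist0E; congr (_ + _).
  case: n => [|n]; first by rewrite big_ord0.
  rewrite big_ord_recl big1 /= ?addr0 => [|i _]; last by rewrite mul0mx.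
  by rewrite /bump /= subn1.
apply/funext => n; apply/eqP; rewrite -subr_eq0; apply/eqP; move: n.
apply: tw_sum_eq0 => z; have [y zy] := e_cvg z.
(* Coefficient n of E tau e involves e_(n-1), so m + 1 terms of the difference use m + 1 terms of e
   next to A but only m next to E. *)
rewrite /tw_sum; apply/cvg_vec_shift.
have := cvg_vecD (proj1 (cvg_vec_shift _ _) (e_fun _ _ zy))
  (cvg_vecN (cvg_vecD (cvg_vec_mulmx A (proj1 (cvg_vec_shift _ _) zy))
                      (cvg_vec_mulmx E (cvg_vec_twist 1 zy)))).
rewrite subrr; congr (cvg_to_vec _ _); apply/funext => m.
under [RHS]eq_bigr => i _.
  rewrite lhsE rhsE mulmxBl mulmxDl -mulmxA -twistM opprD.
  over.
rewrite !big_split /= !sumrN mulmx_sumr opprD; congr (_ + (_ + _)); congr (- _).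
  by apply: eq_bigr => i _; rewrite mulmxA.
rewrite [RHS]big_ord_recl mul0mx add0r twist_sum mulmx_sumr.
by apply: eq_bigr => i _; rewrite twistM twist_twist -mulmxA.
Qed.

End Exponential.

(** * Block vectors *)

Section Blocks.
Variables (F : finFieldType) (R : realType) (C : valuedExt F R).
Hypothesis hC : is_Cinfty C.
Variables (r : nat) (s : r.-tuple nat).

Definition jetcol (d : nat) (f : pser C) : 'cV[C]_d :=
  \col_(a < d) jet (d - a.+1) f.

(** The map J of the overview. *)
Definition jetvec (f : 'I_r -> pser C) : 'cV[C]_(tdim s) :=
  \mxcol_(l < r) jetcol (bdim s l) (f l).

Definition shiftmx (d : nat) : 'M[C]_d :=
  \matrix_(a < d, b < d) (b == a.+1 :> nat)%:R.

Lemma shiftmx_mulE d (x : 'cV[C]_d) (a : 'I_d) :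
  (shiftmx d *m x) a 0 = \sum_(b < d | b == a.+1 :> nat) x b 0.
Proof.
rewrite mxE [RHS]big_mkcond; apply: eq_bigr => b _; rewrite mxE.
by case: eqP => _; rewrite ?mul1r ?mul0r.
Qed.

Lemma shiftmx_mul_lt d (x : 'cV[C]_d) (a b : 'I_d) :
  b = a.+1 :> nat -> (shiftmx d *m x) a 0 = x b 0.
Proof.
move=> bE; rewrite shiftmx_mulE (big_pred1 b) // => c.
by rewrite -bE val_eqE.
Qed.

Lemma shiftmx_mul_last d (x : 'cV[C]_d) (a : 'I_d) :
  a.+1 = d -> (shiftmx d *m x) a 0 = 0.
Proof.
by move=> aE; rewrite shiftmx_mulE big1 // => b; rewrite aE ltn_eqF.
Qed.

(** Leibniz rule row by row: the superdiagonal brings in the Taylor coefficient of order one less,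
    and the last row, of order 0, has none. *)
Lemma shiftmx_jetcol a d f : in_Tate f ->
  ((theta C - a)%:M + shiftmx d) *m jetcol d f =
  jetcol d ((pvar C - pconst a) * f).
Proof.
move=> fT; apply/colP => i; rewrite mulmxDl mul_scalar_mx !mxE.
have [lt_id|] := ltnP i.+1 d; last first.
  move=> le_di; have iE : i.+1 = d by apply/eqP; rewrite eqn_leq ltn_ord.
  have := shiftmx_mul_last (jetcol d f) iE; rewrite mxE => ->.
  by rewrite iE subnn jet0_Xsub // addr0.
have := @shiftmx_mul_lt _ (jetcol d f) i (Ordinal lt_id) erefl.
rewrite !mxE => ->.
by rewrite -[(d - i.+1)%N](subnSK lt_id) jetS_Xsub.
Qed.

(** d rho(t) - a, which corresponds under J to multiplication by t - a. *)
Definition shift_theta (a : C) : 'M[C]_(tdim s) := (theta C - a)%:M + Nmx C s.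

Lemma shift_theta_mxcol a (x : forall l, 'cV[C]_(bdim s l)) :
  shift_theta a *m \mxcol_(l < r) x l =
  \mxcol_(l < r) (((theta C - a)%:M + shiftmx (bdim s l)) *m x l).
Proof.
rewrite /shift_theta -(mxdiagZ (p_ := bdim s)) -mxdiagD.
exact: mul_mxdiag_mxcol.
Qed.

Lemma shift_theta_jetvec a (f : 'I_r -> pser C) : (forall l, in_Tate (f l)) ->
  shift_theta a *m jetvec f = jetvec (fun l => (pvar C - pconst a) * f l).
Proof.
move=> fT; rewrite shift_theta_mxcol; apply/eq_mxcol => l.
exact: shiftmx_jetcol.
Qed.

(** Each block is upper triangular with theta - a on the diagonal; the kernel is cleared from the
    bottom row upwards. *)
Lemma shift_theta_inj a (x y : 'cV[C]_(tdim s)) : theta C - a != 0 ->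
  shift_theta a *m x = shift_theta a *m y -> x = y.
Proof.
move=> a0 /eqP; rewrite -subr_eq0 -mulmxBr => xy0; apply/eqP.
rewrite -subr_eq0; move: (x - y) xy0 => {x y} x.
rewrite -(submxcolK x) shift_theta_mxcol -mxcol0 => /eqP/eq_mxcolP xl0.
apply/eqP/eq_mxcolP => l; move: (submxcol x l) (xl0 l) => {xl0} {}x xl0.
apply/colP => i; rewrite [RHS]mxE.
move: {2}(bdim s l - i)%N (erefl (bdim s l - i)%N) => n.
elim/ltn_ind: n i => n IHn i nE.
have := congr1 (fun z : 'cV_ _ => z i 0) xl0.
rewrite mulmxDl mul_scalar_mx [LHS]mxE [in RHS]mxE [X in X + _ = _]mxE.
have [lt_id|le_di] := ltnP i.+1 (bdim s l).
  rewrite (@shiftmx_mul_lt _ _ _ (Ordinal lt_id)) // (IHn _ _ (Ordinal lt_id) erefl).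
    by rewrite addr0 => /eqP; rewrite mulf_eq0 (negPf a0) => /eqP.
  by rewrite -nE /= ltn_sub2l.
rewrite shiftmx_mul_last; last by apply/eqP; rewrite eqn_leq ltn_ord.
by rewrite addr0 => /eqP; rewrite mulf_eq0 (negPf a0) => /eqP.
Qed.

(* The j-th power of N applied to the last basis vector of block m. *)
Definition blockvec (m : 'I_r) (j : nat) : 'cV[C]_(tdim s) :=
  \mxcol_(l < r) \col_(a < bdim s l) ((l == m) && (a.+1 + j == bdim s l)%N)%:R.

Lemma Nmx_blockvec m j : Nmx C s *m blockvec m j = blockvec m j.+1.
Proof.
rewrite /Nmx mul_mxdiag_mxcol; apply/eq_mxcol => l; apply/colP => a.
rewrite -/(shiftmx _); have [lt_ad|le_da] := ltnP a.+1 (bdim s l).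
  by rewrite (@shiftmx_mul_lt _ _ _ (Ordinal lt_ad)) // !mxE addnS.
have aE : a.+1 = bdim s l by apply/eqP; rewrite eqn_leq ltn_ord.
by rewrite shiftmx_mul_last // mxE aE gtn_eqF ?andbF // addnS ltnS leq_addr.
Qed.

Lemma blockvec_eq0 m j : (bdim s m <= j)%N -> blockvec m j = 0.
Proof.
move=> le_dj; rewrite -mxcol0; apply/eq_mxcol => l; apply/colP => a; rewrite !mxE.
case: eqP => // lm; rewrite andTb gtn_eqF //; rewrite -lm in le_dj.
by rewrite addSn ltnS (leq_trans le_dj) // leq_addl.
Qed.

Lemma blockvecE m j l (a : 'I_(bdim s l)) :
  blockvec m j (tagnat.Rank l a) 0 = ((l == m) && (a.+1 + j == bdim s l)%N)%:R.
Proof.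
have := congr1 (fun z : 'cV_ _ => z a 0) (mxcolK (fun l =>
  \col_(a < bdim s l) ((l == m) && (a.+1 + j == bdim s l)%N)%:R : 'cV[C]__) l).
by rewrite mxE [RHS]mxE.
Qed.

(** N^j eps_m is the basis vector of row d_m - j in block m, and E sees only the first row of each
    block, reached exactly for j = d_m - 1. *)
Lemma Emx_blockvec (u : r.-tuple C) m j : (0 < bdim s m)%N ->
  Emx s u *m blockvec m j = if j.+1 == bdim s m then
    \sum_(l < r | (l <= m)%N)
      ((-1) ^+ (m - l) * \prod_(l <= e < m) u`_e) *: blockvec l 0
  else 0.
Proof.
move=> d_gt0; rewrite /Emx mxblockEv mxcol_mul; apply/mxcolP => l.
rewrite mxcolK mul_mxrow_mxcol (bigD1 m) //=.
rewrite [X in _ + X]big1 ?addr0 => [|k k_m]; last first.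
  by apply/colP => a; rewrite !mxE big1 // => b _; rewrite !mxE (negPf k_m) mulr0.
apply/colP => a; rewrite mxE (bigD1 (Ordinal d_gt0)) //=.
rewrite [X in _ + X]big1 ?addr0 => [|b b0]; last first.
  by rewrite mxE -[X in [&& _, _ & X]]/(b == Ordinal d_gt0) (negPf b0) !andbF mul0r.
rewrite !mxE eqxx andbT andTb add1n; case: (j.+1 == _); last by rewrite mxE mulr0.
rewrite mulr1 summxE; have [le_lm|lt_ml] := leqP l m => /=.
  rewrite (bigD1 l) //= [X in _ + X]big1 ?addr0 => [|k /andP[_ k_l]].
    by rewrite mxE blockvecE eqxx addn0; case: eqP; rewrite ?mulr1 ?mulr0.
  by rewrite mxE blockvecE eq_sym (negPf k_l) mulr0.
rewrite big1 // => k le_km; rewrite mxE blockvecE.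
case: eqP => [lk|_]; last by rewrite mulr0.
by rewrite lk ltnNge le_km in lt_ml.
Qed.

Lemma blockvec_jetvec m :
  blockvec m 0 = jetvec (fun l => if l == m then 1 else 0).
Proof.
apply/eq_mxcol => l; apply/colP => a; rewrite !mxE addn0.
case: eqP => _ /=; last by rewrite jet0.
by rewrite jet1 // subn_eq0 [LHS](_ : _ = (bdim s l <= a.+1)%:R) // eqn_leq ltn_ord.
Qed.

Lemma jetvecD (f g : 'I_r -> pser C) :
  (forall l, in_Tate (f l)) -> (forall l, in_Tate (g l)) ->
  jetvec (fun l => f l + g l) = jetvec f + jetvec g.
Proof.
move=> fT gT; rewrite -mxcolD; apply/eq_mxcol => l; apply/colP => a.
by rewrite !mxE jetD.
Qed.

Lemma jetvec0 : jetvec (fun=> 0) = 0.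
Proof.
by rewrite -mxcol0; apply/eq_mxcol => l; apply/colP => a; rewrite !mxE jet0.
Qed.

Lemma jetvec_scale x (f : 'I_r -> pser C) : (forall l, in_Tate (f l)) ->
  jetvec (fun l => pconst x * f l) = x *: jetvec f.
Proof.
move=> fT; apply/mxcolP => l; rewrite mxcolK; apply/colP => a.
rewrite !mxE jet_scale //; congr (_ * _).
have := congr1 (fun z : 'cV_ _ => z a 0) (mxcolK (fun l => jetcol (bdim s l) (f l)) l).
by rewrite !mxE => ->.
Qed.

Lemma jetvec_sum (I : finType) (P : pred I) (x : I -> C) (f : I -> 'I_r -> pser C) :
  (forall i l, in_Tate (f i l)) ->
  jetvec (fun l => \sum_(i | P i) pconst (x i) * f i l) =
  \sum_(i | P i) x i *: jetvec (f i).
Proof.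
move=> fT.
have fxT i l : in_Tate (pconst (x i) * f i l) by apply: in_Tate_scale.
elim: (index_enum I) => [|i t IHt].
  by rewrite big_nil -jetvec0; congr jetvec; apply/funext => l; rewrite big_nil.
rewrite big_cons -IHt; case: ifP => Pi; last first.
  by congr jetvec; apply/funext => l; rewrite big_cons Pi.
rewrite -jetvec_scale // -jetvecD //.
  by congr jetvec; apply/funext => l; rewrite big_cons Pi.
move=> l; elim/big_ind: _ => //; last by move=> ? ?; apply: in_TateD.
by rewrite -(rmorph0 (@pconst C)); apply/(overconv_in_Tate hC)/overconv_const.
Qed.

End Blocks.

(** * Lists, index ranges and signs *)

Lemma rev_drop_takeS (T : Type) (x0 : T) (t : seq T) k m :
  (k <= m)%N -> (m < size t)%N ->
  rev (drop k (take m.+1 t)) = nth x0 t m :: rev (drop k (take m t)).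
Proof.
move=> le_km lt_mt; rewrite (take_nth x0) // drop_rcons ?rev_rcons //.
by rewrite size_takel // ltnW.
Qed.

Lemma sum_nat_ord (V : nmodType) (G : nat -> V) k m r : (m <= r)%N ->
  \sum_(k <= i < m) G i = \sum_(i < r | (k <= i < m)%N) G i.
Proof.
move=> le_mr; rewrite (big_nat_widen _ _ _ _ _ le_mr).
rewrite (@big_nat_widenl _ _ _ k 0%N) // big_mkord.
by apply: eq_bigl => i; rewrite andTb andbC.
Qed.

Lemma prod_drop (A : pzRingType) (t : seq A) k :
  \prod_(x <- drop k t) x = \prod_(k <= i < size t) t`_i.
Proof.
rewrite (big_nth 0) size_drop -[k in RHS]add0n big_addn.
by apply: eq_bigr => i _; rewrite nth_drop addnC.
Qed.

Lemma sign_sub (A : pzRingType) a b c : (a <= b <= c)%N ->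
  (-1) ^+ (c - a) = (-1) ^+ (c - b) * (-1) ^+ (b - a) :> A.
Proof.
move=> /andP[le_ab le_bc]; rewrite -exprD; congr (_ ^+ _).
by rewrite addnBA // subnK.
Qed.

(** * The logarithm at v *)

Section Logarithm.
Variables (F : finFieldType) (R : realType) (C : valuedExt F R).
Hypothesis hC : is_Cinfty C.
Variables (r : nat) (s : r.-tuple nat) (u : r.-tuple C).
Hypothesis bdim_gt0 : forall m : 'I_r, (0 < bdim s m)%N.

Notation q := #|F|%:R.

(** T_n[k,m] of the overview with indices counted from 0: it involves the entries k, ..., m - 1 of s
    and u, with m - 1 outermost. At m = r it is a partial sum of a polylogarithm of the theorem. *)
Definition starT (k m n : nat) : pser C :=
  tLi_partial (rev (drop k (take m s))) (rev (drop k (take m u))) n.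

Lemma starTkk k n : starT k k n = 1.
Proof.
by rewrite /starT !(drop_oversize (n := k)) ?size_take_min ?geq_minl // tLi_partial_nil.
Qed.

Lemma starT0 k m : (k < m <= r)%N -> starT k m 0 = 0.
Proof.
case: m => // m /andP[le_km lt_mr]; rewrite /starT.
by rewrite (@rev_drop_takeS _ 0%N _ k m le_km) ?size_tuple // tLi_partial0.
Qed.

Lemma starTS k m n : (k <= m < r)%N ->
  starT k m.+1 n.+1 =
  starT k m.+1 n + tLi_factor (nth 0%N s m) u`_m n * starT k m n.+1.
Proof.
move=> /andP[le_km lt_mr]; rewrite /starT.
rewrite (rev_drop_takeS 0%N le_km) ?size_tuple //.
by rewrite (rev_drop_takeS 0 le_km) ?size_tuple // tLi_partialS.
Qed.

Lemma overconv_starT k m n : overconv (starT k m n).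
Proof.
by apply: overconv_tLi_partial; rewrite // !size_rev !size_drop !size_take !size_tuple.
Qed.

(** [bdim] indexed by natural numbers, so that m = r, with value 0, is allowed. *)
Definition taildim (m : nat) : nat := \sum_(x <- drop m s) x.

Lemma taildimS m : (m < r)%N -> taildim m = (nth 0 s m + taildim m.+1)%N.
Proof.
by move=> lt_mr; rewrite /taildim (drop_nth 0%N) ?size_tuple // big_cons.
Qed.

(** In a chain j_k <= ... <= j_(m-1) < n + 1 let l be the place from which on all indices equal n.
    The entries before l contribute T_n[k,l], and those from l on contribute the u_e^(q^n) and the
    powers of 1 / LL_n that raise d_m to d_l. *)
Lemma starT_sum n k m : (k <= m <= r)%N ->
  \sum_(k <= l < m.+1) pconst (frob n (\prod_(l <= e < m) u`_e)) *
     (starT k l n * (inv_bbL C n : pser C) ^+ taildim l) =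
  (inv_bbL C n : pser C) ^+ taildim m * starT k m n.+1.
Proof.
move=> /andP[le_km]; rewrite -(subnKC le_km); elim: (m - k)%N => {m le_km} [|i IHi].
  by rewrite addn0 big_nat1 big_geq // !rmorph1 !starTkk mul1r mulrC.
rewrite addnS => lt_r; have lt_ik : (k <= (k + i).+1)%N by rewrite -addnS leq_addr.
rewrite big_nat_recr //=.
rewrite [X in pconst (frob n X) * (starT k _.+1 _ * _)]big_geq // !rmorph1 mul1r.
transitivity (pconst (frob n u`_(k + i)) *
    \sum_(k <= l < (k + i).+1) pconst (frob n (\prod_(l <= e < (k + i)%N) u`_e)) *
     (starT k l n * (inv_bbL C n : pser C) ^+ taildim l) +
    starT k (k + i).+1 n * (inv_bbL C n : pser C) ^+ taildim (k + i).+1).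
  congr (_ + _); rewrite big_distrr /= big_nat [RHS]big_nat.
  apply: eq_bigr => l /andP[_ le_l]; rewrite big_nat_recr //= !rmorphM /=.
  by rewrite -mulrA mulrCA.
rewrite IHi; last exact: ltnW.
rewrite starTS ?leq_addr //= mulrDr addrC; congr (_ + _); first by rewrite mulrC.
rewrite taildimS // exprD /tLi_factor.
rewrite -[u`_ _ ^+ _]/(frob n _).
ring.
Qed.

(* Block k of the preimage of l_n eps_m under J. *)
Definition log_col (n : nat) (m k : 'I_r) : pser C :=
  if (k <= m)%N then
    pconst ((-1) ^+ (m - k)) * (starT k m n * (inv_bbL C n : pser C) ^+ taildim m)
  else 0.

Lemma overconv_log_col n m k : overconv (log_col n m k).
Proof.
rewrite /log_col; case: ifP => _; last exact: overconv0.
apply: overconvM => //; first exact: overconv_const.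
by apply: overconvM => //; [apply: overconv_starT|apply/overconvX/overconv_inv_bbL].
Qed.

Lemma in_Tate_log_col n m k : in_Tate (log_col n m k).
Proof. exact/(overconv_in_Tate hC)/overconv_log_col. Qed.

Lemma twist_Nmx n : twist n (Nmx C s) = Nmx C s.
Proof.
apply/mxblockP => i j; transitivity (twist n (submxblock (Nmx C s) i j)).
  by apply/matrixP => a b; rewrite !mxE.
rewrite /Nmx /mxdiag mxblockK; case: eqP => [<-|_]; last exact: twist0.
by rewrite conform_mx_id; apply/matrixP => a b; rewrite !mxE -/(frob n _) rmorph_nat.
Qed.

Lemma frob_prod n k m :
  frob n (\prod_(k <= e < m) u`_e) = \prod_(k <= e < m) (map_tuple (frob n) u)`_e.
Proof.
rewrite rmorph_prod; apply: eq_bigr => e _ /=.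
have [lt_e|le_e] := ltnP e (size u); first by rewrite (nth_map 0).
by rewrite !nth_default ?size_map // rmorph0.
Qed.

(** This brings E^(n) under [Emx_blockvec]. *)
Lemma twist_Emx n : twist n (Emx s u) = Emx s (map_tuple (frob n) u).
Proof.
apply/matrixP => i j; rewrite twistE !mxE; case: ifP => _; last by rewrite rmorph0.
by rewrite rmorphM rmorph_sign /= frob_prod.
Qed.

(** * Solution of the recursion for the coefficients of the logarithm *)

Section Recursion.
Variable l : nat -> 'M[C]_(tdim s).
Hypothesis l0 : l 0%N = 1%:M.
Hypothesis lS : forall n, l n.+1 *m twist n.+1 (drho_t C s) +
  l n *m twist n (Emx s u) = drho_t C s *m l n.+1.

Notation shiftA n := (shift_theta s (theta C ^+ (#|F| ^ n)%N)).

Lemma log_shift n (x : 'cV[C]_(tdim s)) :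
  shiftA n.+1 *m (l n.+1 *m x) =
  l n.+1 *m (Nmx C s *m x) + l n *m (twist n (Emx s u) *m x).
Proof.
have := congr1 (mulmx^~ x) (lS n); rewrite /drho_t twistD twist_scalar twist_Nmx.
rewrite !mulmxDl !mulmxDr mul_mx_scalar !mulmxDl !mul_scalar_mx -!scalemxAl => H.
rewrite /shift_theta scalerBl addrAC !mulmxA -H.
by rewrite [LHS]addrC -addrA addKr.
Qed.

(** While j + 1 < d_m, E^(n) kills N^j eps_m, so each step only moves along block m. *)
Lemma log_shift_iter n (m : 'I_r) j : (j < bdim s m)%N ->
  iter j (mulmx (shiftA n.+1)) (l n.+1 *m blockvec C s m 0) =
  l n.+1 *m blockvec C s m j.
Proof.
elim: j => // j IHj lt_j; rewrite iterS IHj ?(ltnW lt_j) // log_shift.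
rewrite Nmx_blockvec twist_Emx Emx_blockvec // ltn_eqF //.
by rewrite mulmx0 addr0.
Qed.

Lemma shift_iter_inj n d (x y : 'cV[C]_(tdim s)) :
  iter d (mulmx (shiftA n.+1)) x = iter d (mulmx (shiftA n.+1)) y -> x = y.
Proof.
elim: d => // d IHd; rewrite !iterS => /shift_theta_inj H; apply/IHd/H => //.
exact: theta_frob_neq0.
Qed.

Lemma shift_iter_jetvec a d (f : 'I_r -> pser C) : (forall k, overconv (f k)) ->
  iter d (mulmx (shift_theta s a)) (jetvec s f) =
  jetvec s (fun k => (pvar C - pconst a) ^+ d * f k).
Proof.
move=> fo; elim: d => [|d IHd].
  by congr jetvec; apply/funext => k; rewrite mul1r.
rewrite iterS IHd shift_theta_jetvec //.
  by congr jetvec; apply/funext => k; rewrite exprS mulrA.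
move=> k; apply/(overconv_in_Tate hC)/overconvM => //; apply: overconvX => //.
apply: overconvD => //; first exact: overconv_var.
by apply: overconvN => //; apply: overconv_const.
Qed.

Lemma log_blockvec n (m : 'I_r) : l n *m blockvec C s m 0 = jetvec s (log_col n m).
Proof.
elim: n m => [|n IHn] m.
  (* T_0[k,m] is 0 for k < m and 1 for k = m, in agreement with l_0 = 1. *)
  rewrite l0 mul1mx blockvec_jetvec //; congr jetvec; apply/funext => k.
  rewrite /log_col inv_bbL0 expr1n mulr1; case: eqP => [->|/eqP k_m].
    by rewrite leqnn subnn rmorph1 mul1r starTkk.
  case: ifP => // le_km; rewrite starT0 ?mulr0 //.
  by rewrite ltn_neqAle val_eqE k_m le_km ltnW.
(* Both sides are compared after d_m applications of the injective matrix theta - theta^(q^(n+1)) +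
   N. *)
apply: (@shift_iter_inj n (bdim s m)); rewrite shift_iter_jetvec; last first.
  by move=> k; apply: overconv_log_col.
rewrite -[in LHS](prednK (bdim_gt0 m)) iterS log_shift_iter ?prednK //.
(* In the last application N^(d_m) eps_m = 0, and E^(n) contributes the l_n eps_i with i <= m. *)
rewrite log_shift Nmx_blockvec prednK // blockvec_eq0 // mulmx0 add0r.
rewrite twist_Emx Emx_blockvec // prednK // eqxx mulmx_sumr.
under eq_bigr => k _ do rewrite -scalemxAr IHn.
rewrite -jetvec_sum //; last by move=> i k; apply: in_Tate_log_col.
congr jetvec; apply/funext => k; rewrite {2}/log_col.
case: (leqP k m) => [le_km|lt_mk]; last first.
  rewrite mulr0 big1 // => i le_im; rewrite /log_col leqNgt (leq_ltn_trans le_im) //.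
  by rewrite mulr0.
(* The power (t - theta^(q^(n+1)))^(d_m) turns 1 / LL_(n+1)^(d_m) into 1 / LL_n^(d_m), the shape
   required by [starT_sum]. *)
transitivity (pconst ((-1) ^+ (m - k)) *
  ((inv_bbL C n : pser C) ^+ taildim m * starT k m n.+1)); last first.
  rewrite -inv_bbLK //.
  rewrite exprMn; ring.
rewrite -starT_sum ?le_km 1?ltnW // big_distrr /= (@sum_nat_ord _ _ _ _ r) //.
rewrite big_mkcond [RHS]big_mkcond; apply: eq_bigr => i _.
rewrite ltnS andbC; case: ifP => //= le_im; rewrite /log_col.
case: ifP => le_ki; last by rewrite mulr0.
rewrite -frob_prod (sign_sub _ (_ : k <= i <= m)%N) ?le_ki // !rmorphM /= !rmorph_sign.
ring.
Qed.

Lemma vpointE : vpoint s u =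
  \sum_(m < r) ((-1) ^+ (r.-1 - m) * \prod_(m <= e < r) u`_e) *: blockvec C s m 0.
Proof.
apply/mxcolP => k; rewrite mxcolK; apply/colP => a.
rewrite !mxE summxE (bigD1 k) //= [X in _ + X]big1 ?addr0 => [|i i_k]; last first.
  by rewrite mxE blockvecE eq_sym (negPf i_k) mulr0.
rewrite mxE blockvecE eqxx addn0; case: eqP => _; rewrite ?mulr0 ?mulr1 //=.
by congr (_ * _); rewrite prod_drop size_tuple.
Qed.

Lemma twist_blockvec n (m : 'I_r) j : twist n (blockvec C s m j) = blockvec C s m j.
Proof.
by apply/matrixP => a b; rewrite twistE !mxE rmorph_nat.
Qed.

(** Each step is [starT_sum] at m = r, where [taildim] is 0: the summand of index r is the previous
    partial sum, and the others come from l_n v^(n). *)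
Lemma log_partial_sum M : \sum_(n < M) l n *m twist n (vpoint s u) =
  jetvec s (fun k => pconst ((-1) ^+ (r.-1 - k)) * starT k r M).
Proof.
have TT k n : in_Tate (starT k r n) by apply/(overconv_in_Tate hC)/overconv_starT.
elim: M => [|n IHn].
  rewrite big_ord0 -jetvec0 //; congr jetvec; apply/funext => k.
  by rewrite starT0 ?mulr0 // ltn_ord leqnn.
rewrite big_ord_recr /= IHn vpointE twist_sum mulmx_sumr.
under [X in _ + X]eq_bigr => m _ do
  rewrite twistE map_mxZ -twistE twist_blockvec -scalemxAr log_blockvec.
rewrite -jetvec_sum //; last by move=> i k; apply: in_Tate_log_col.
rewrite -jetvecD // => [|k|k]; last 2 first.
- exact: in_Tate_scale.
- apply/(overconv_in_Tate hC)/overconv_sum => // m _; apply: overconvM => //.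
    exact: overconv_const.
  exact: overconv_log_col.
congr jetvec; apply/funext => k.
have := @starT_sum n k r; rewrite (ltnW (ltn_ord k)) leqnn => /(_ isT).
rewrite big_nat_recr ?(ltnW (ltn_ord k)) //= [X in pconst (frob n X)]big_geq //.
have -> : taildim r = 0%N by rewrite /taildim drop_oversize ?size_tuple // big_nil.
rewrite !rmorph1 mul1r mulr1 mul1r => <-; rewrite mulrDr addrC; congr (_ + _).
rewrite big_distrr /= (@sum_nat_ord _ _ _ _ r) // [RHS]big_mkcond; apply: eq_bigr => m _.
rewrite ltn_ord andbT /log_col; case: ifP => le_km; last by rewrite mulr0.
have le_mr : (m <= r.-1)%N by rewrite -ltnS (ltn_predK (ltn_ord m)).
rewrite (sign_sub _ (_ : k <= m <= r.-1)%N) ?le_km // !rmorphM /= !rmorph_sign.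
ring.
Qed.

End Recursion.
End Logarithm.

(** * Passage to the limit in Log(v) *)

Lemma nth_rev_drop_take (T : Type) (x0 : T) (t : seq T) k m a :
  (m <= size t)%N -> (a < m - k)%N ->
  nth x0 (rev (drop k (take m t))) a = nth x0 t (k + (m - k - a.+1))%N.
Proof.
move=> le_mt lt_a; have sz : size (drop k (take m t)) = (m - k)%N.
  by rewrite size_drop size_takel.
by rewrite nth_rev sz // nth_drop nth_take //; lia.
Qed.

(** The first clause certifies that [tLi] is a true limit and not the default of [lim_Tate]; the
    second identifies the last row of each block with the value of the star polylogarithm; [tw_sum]
    in the third asserts convergence together with the value. *)
Theorem theorem3p3p3 (F : finFieldType) (R : realType) (C : valuedExt F R)
    (hC : is_Cinfty C)
    (r : nat) (hr : (0 < r)%N)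
    (s : r.-tuple nat) (hs : forall i : 'I_r, (0 < tnth s i)%N)
    (u : r.-tuple C) (hu : forall i : 'I_r, in_Kbar (tnth u i))
    (hu_le : forall i : 'I_r, (i.+1 < r)%N ->
       vabs (tnth u i) <= polylog_radius F R (tnth s i))
    (hu_lt : forall i : 'I_r, i.+1 = r ->
       vabs (tnth u i) < polylog_radius F R (tnth s i))
    (e : nat -> 'M[C]_(tdim s)) (he : is_Exp u e)
    (l : nat -> 'M[C]_(tdim s)) (hl : is_Log e l) :
  [/\ forall i : 'I_r,
        cvg_to_Tate (tLi_partial (rev (drop i s)) (rev (drop i u)))
                    (tLi (rev (drop i s)) (rev (drop i u))),
      forall (i : 'I_r) (a : 'I_(bdim s i)), a.+1 = bdim s i ->
        cvg_to_C (fun M => (-1) ^+ (r.-1 - i) *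
                    Li_partial (rev (drop i s)) (rev (drop i u)) M)
                 (Yblock s u i a 0)
    & tw_sum l (vpoint s u) (Yvec s u)].
Proof.
have bdim_gt0 (i : 'I_r) : (0 < bdim s i)%N.
  rewrite -[bdim s i]/(taildim s i) taildimS ?ltn_ord // ltn_addr //.
  by rewrite -tnth_nth.
have szE (i : 'I_r) : size (rev (drop i s)) = size (rev (drop i u)).
  by rewrite !size_rev !size_drop !size_tuple.
have cvgL (i : 'I_r) : cvg_to_Tate (tLi_partial (rev (drop i s)) (rev (drop i u)))
    (tLi (rev (drop i s)) (rev (drop i u))).
  have lt_r : (r.-1 < r)%N by rewrite prednK.
  have le_ir : (i <= r.-1)%N by rewrite -ltnS prednK.
  (* The outermost entry of the reversed lists is the last one of s and u, the one with the strict
     bound. *)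
  have revE (T : Type) (x0 : T) (t : r.-tuple T) :
      rev (drop i t) = nth x0 t r.-1 :: rev (drop i (take r.-1 t)).
    rewrite -rev_drop_takeS ?size_tuple // prednK //.
    by rewrite take_oversize // size_tuple.
  rewrite (revE _ 0%N s) (revE _ 0 u).
  have szt (T : Type) (t : r.-tuple T) : size (drop i (take r.-1 t)) = (r.-1 - i)%N.
    by rewrite size_drop size_takel // size_tuple leq_pred.
  apply: cvg_tLi => // [||a].
  - by rewrite !size_rev !szt.
  - have := hu_lt (Ordinal lt_r); rewrite (tnth_nth (0 : C)) (tnth_nth 0%N) /=.
    by apply; rewrite prednK.
  rewrite size_rev szt => lt_a.
  rewrite !nth_rev_drop_take ?size_tuple ?leq_pred //.
  have lt_j : (i + (r.-1 - i - a.+1) < r)%N by lia.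
  have := hu_le (Ordinal lt_j); rewrite (tnth_nth (0 : C)) (tnth_nth 0%N) /=.
  by apply; lia.
have TT (i : 'I_r) M : in_Tate (tLi_partial (rev (drop i s)) (rev (drop i u)) M).
  exact: in_Tate_tLi_partial.
split=> // [i a aE|].
  rewrite mxE aE subnn; apply: cvgCZ => //.
  have := cvg_jet_Tate hC 0 (TT i) (cvgL i).
  congr (cvg_to_C _ _); apply/funext => M; exact: jet0_tLi_partial.
have [e0 e_cvg e_fun] := he.
have eAE := exp_intertwine hC e_cvg e_fun.
have lS := log_recursion hl eAE.
have l0 : l 0%N = 1%:M.
  have /(_ 0%N) := hl.1; rewrite /tw_mul big_ord1 e0 mul1mx /tw_one /= => <-.
  by rewrite twist0E.
(* The partial sums are images under J of those of the polylogarithms; each coordinate converges by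
   continuity of a Taylor coefficient. *)
rewrite /tw_sum (funext (log_partial_sum hC bdim_gt0 l0 lS)) => x.
set i := tagnat.sig1 x; set a := tagnat.sig2 x.
have := cvgCZ hC ((-1) ^+ (r.-1 - i))
  (cvg_jet_Tate hC (bdim s i - a.+1) (TT i) (cvgL i)).
rewrite [Yvec _ _ _ _]mxE [Yblock _ _ _ _ _]mxE; congr (cvg_to_C _ _).
apply/funext => M; rewrite [RHS]mxE [RHS]mxE jet_scale //; last first.
  by apply/(overconv_in_Tate hC)/overconv_starT.
by rewrite /starT !take_oversize ?size_tuple.
Qed.
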